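(* Let $\{\eta(t): t\in T\}$ be a non-negative stochastic process in the max-domain of attraction of the max-stable process $\xi$, normalized such that, for independent copies $\eta_1,\eta_2,\dots$ of $\eta$, $\frac{1}{n}\max_{i=1}^n \eta_i(t) \to \xi(t)$, $t\in T$, as $n\to\infty$ in the sense of finite-dimensional distributions (i.e. the norming functions are $c_n(t)=1/n$, $b_n(t)=0$). Let $a(n)\to\infty$ as $n\to\infty$. Then for every $k\in\mathbb{N}$ and $t_0,\dots,t_k\in T$ we have convergence in distribution on $\mathbb{R}^{k+1}$ $$\left(\frac{\eta(t_0)}{a(n)}, \frac{\eta(t_1)}{\eta(t_0)},\dots,\frac{\eta(t_k)}{\eta(t_0)} \ \Bigg|\ \eta(t_0) > a(n)\right) \xrightarrow{d} \left(Z, \Delta\tilde{\mathbf{V}}^{(1)}\right),\quad n\to\infty,$$ where $Z$ is a standard Pareto random variable independent of $\Delta\tilde{\mathbf{V}}^{(1)}$, and the law of $\Delta\tilde{\mathbf{V}}^{(1)}$ is given by $$\mathbb{P}(\Delta\tilde{\mathbf{V}}^{(1)}\in d\mathbf{z}) = (1-p)\,\mathbb{P}(\Delta\mathbf{V}^{(1)}\in d\mathbf{z})\,\mathbb{E}\bigl(V^{(1)}(t_0)\,\big|\,\Delta\mathbf{V}^{(1)}=\mathbf{z}\bigr),\quad \mathbf{z}\geq \mathbf{0},$$ with $\Delta\mathbf{V}^{(1)} = \left(\frac{V^{(1)}(t_1)}{V^{(1)}(t_0)},\dots,\frac{V^{(1)}(t_k)}{V^{(1)}(t_0)}\right)$ the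 vector of increments with respect to $t_0$.
   Context: $T$ is an arbitrary index set. The process $\{\xi(t): t\in T\}$ has standard Fréchet margins (distribution function $\exp(-1/x)$, $x\ge0$) and admits the representation $\xi(t)=\max_{i\in\mathbb{N}} U_i V_i(t)$, $t\in T$, where $\sum_{i\in\mathbb{N}}\delta_{U_i}$ is a Poisson point process on $(0,\infty)$ with intensity $u^{-2}\,du$ and $V_1,V_2,\dots$ are independent copies of a non-negative stochastic process $\{V(t): t\in T\}$ with $\mathbb{E}V(t)=1$ for all $t\in T$. For the fixed point $t_0\in T$, $p=\mathbb{P}(V(t_0)=0)$, and $V^{(1)}$ denotes the process $V$ conditioned on the event $\{V(t_0)>0\}$. *)

(* Defs.v *)
From HB Require Import structures.
From mathcomp Require Import all_boot all_order all_algebra.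
From mathcomp Require Import all_classical all_reals all_analysis.
Set Implicit Arguments. Unset Strict Implicit. Unset Printing Implicit Defensive.
Import Order.TTheory GRing.Theory Num.Theory.
Import numFieldNormedType.Exports.
Local Open Scope classical_set_scope.
Local Open Scope ring_scope.

Section Defs.
Context {R : realType}.

Definition Ex {d} {O : measurableType d} (P : probability O R) (g : O -> R) : R :=
  fine (\int[P]_w (g w)%:E).

Definition condEx {d} {O : measurableType d} (P : probability O R)
  (A : set O) (g : O -> R) : R :=
  fine (\int[P]_(w in A) (g w)%:E) / fine (P A).

Definition cvg_in_law {d1 d2} {O1 : measurableType d1} {O2 : measurableType d2}
  (P1 : probability O1 R) (P2 : probability O2 R) (m : nat)
  (X : nat -> O1 -> 'rV[R]_m) (Y : O2 -> 'rV[R]_m) : Prop :=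
  forall f : 'rV[R]_m -> R, continuous f -> (exists M : R, forall x, `|f x| <= M) ->
    (fun n => Ex P1 (f \o X n)) @ \oo --> Ex P2 (f \o Y).

(* finite-dimensional cylinder events {X i1 <= x1, ..., X il <= xl} of a
   family X of real random variables (a pi-system generating sigma(X)) *)
Definition cyl {I : Type} {O : Type} (X : I -> O -> R) : set (set O) :=
  [set A | exists s : seq (I * R),
     A = [set w | all (fun ix => X ix.1 w <= ix.2) s]].

Definition mutually_indep {d} {O : measurableType d} (P : probability O R)
  {K : eqType} (F : K -> set (set O)) : Prop :=
  forall (J : seq K) (A : K -> set O), uniq J ->
    (forall j, j \in J -> F j (A j)) ->
    fine (P (\big[setI/setT]_(j <- J) A j)) = \prod_(j <- J) fine (P (A j)).

Definition same_fdd {T : Type} {d1 d2} {O1 : measurableType d1} {O2 : measurableType d2}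
  (P1 : probability O1 R) (P2 : probability O2 R)
  (X : T -> O1 -> R) (Y : T -> O2 -> R) : Prop :=
  forall s : seq (T * R),
    P1 [set w | all (fun tx => X tx.1 w <= tx.2) s] =
    P2 [set w | all (fun tx => Y tx.1 w <= tx.2) s].

(* the event {N((a,b]) = m} for the point process sum_i delta_{U i} *)
Definition count_eq {O : Type} (U : nat -> O -> R) (a b : R) (m : nat) : set O :=
  [set w | exists s : seq nat,
     [/\ uniq s, size s = m & forall i, (a < U i w <= b) <-> i \in s]].

(* sum_i delta_{U i} is a Poisson point process on (0,oo) with intensity
   u^-2 du: points in (0,oo), and the counts in finitely many pairwise disjoint
   intervals (a,b], 0<a<b, are independent Poisson(1/a - 1/b). *)
Definition PPP_u2 {d} {O : measurableType d} (P : probability O R)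
  (U : nat -> O -> R) : Prop :=
  (forall i, measurable_fun [set: O] (U i)) /\
  (forall i w, 0 < U i w) /\
  forall J : seq ((R * R) * nat),
    all (fun j => 0 < j.1.1 < j.1.2) J ->
    pairwise (fun j j' => (j.1.2 <= j'.1.1) || (j'.1.2 <= j.1.1)) J ->
    fine (P (\big[setI/setT]_(j <- J) count_eq U j.1.1 j.1.2 j.2)) =
    \prod_(j <- J)
      (expR (- (j.1.1^-1 - j.1.2^-1)) * (j.1.1^-1 - j.1.2^-1) ^+ j.2 / (j.2`!)%:R).

End Defs.

(* Main.v *)
(* The exponent measure of xi is computed from its Poisson representation: marking
   the points U_i that fall in the cells of a geometric grid by the independent
   events W_i <= y gives P(U_i W_i <= x for all i) = exp(- E W / x) with
   W = max_j c_j V(t_j), first up to the ratio q of the grid, then as q -> 1.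
   Since P(max_j c_j eta(t_j) <= n)^n converges to this value at x = 1, one gets
   s P(max_j c_j eta(t_j) > s) -> E max_j c_j V(t_j) as s -> oo, for all positive
   weights c.  By inclusion-exclusion this determines the limit of
   s P(eta(t_0) > s, eta(t_j) <= s x_j for all j), which is the mass of an orthant
   under the image of z^-2 dz E[V(t_0); .], z >= 1, by z V(t_j) / V(t_0).  A
   continuous function is uniformly close on a box to a finite combination of
   indicators of orthants, so orthants determine weak convergence, and dividing by
   the first coordinate is a continuous map. *)
Require Import Defs.
From HB Require Import structures.
From mathcomp Require Import all_boot all_order all_algebra.
From mathcomp Require Import all_classical all_reals all_analysis.
From mathcomp Require Import measurable_realfun ring lra.
Import Order.TTheory GRing.Theory Num.Theory.
Import numFieldNormedType.Exports.
Local Open Scope classical_set_scope.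
Local Open Scope ring_scope.

Set Implicit Arguments.
Unset Strict Implicit.
Unset Printing Implicit Defensive.

(** * Approximation by indicators of orthants *)

(** Three obstacles shape the argument. [PPP_u2] speaks only of counts in finitely many intervals,
    so the marked process is reached through finite patterns, which record the cell of each of the
    first n points; the marks are independent given a pattern, and summing over the counts yields
    the Poisson generating function. Next, [xi] is a real supremum, with value 0 where its family is
    unbounded; that this has probability 0 is read off from the computed law itself. Finally,
    quotients by eta(t_0) are discontinuous at 0 and the laws are conditional. Both difficulties
    disappear for the measures of density s times the indicator of eta(t_0) > s, carried to the
    vectors eta(t_j) / s: their mass tends to E V(t_0) = 1, a conditional expectation is a ratio of
    two integrals, and the first coordinate exceeds 1 on the support, so that a quotient by its
    maximum with 1 is continuous and exact. Inclusion-exclusion needs positive weights only: for m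
    the maximum of the eta(t_j) / x_j, the events max(eta(t_0), m) > s and m > s differ by the event
    eta(t_0) > s >= m, and max(eta(t_0), m) is m with its weight at t_0 raised. *)

(** Compactness of the box in near-covering form: a property that holds near each point for all
    small radii holds with one radius on the whole box. Only [x] is confined to the box, and
    closeness is measured coordinate by coordinate. *)
Lemma box_uniform_continuity (R : realType) (d : nat) (g : 'rV[R]_d -> R) (L e : R) :
  continuous g -> 0 < e -> exists2 delta : R, 0 < delta &
    forall x y : 'rV[R]_d, (forall j, 0 <= x ord0 j <= L) ->
      (forall j, `|x ord0 j - y ord0 j| < delta) -> `|g x - g y| < e.
Proof.
move=> gc e0.
have cK : compact [set v : 'rV[R]_d | forall j, `[0, L]%classic (v ord0 j)].
  by apply: (@rV_compact R d (fun=> `[0, L]%classic)) => _; exact: segment_compact.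
have /compact_near_coveringP/near_covering_withinP := cK.
move=> /(_ R (0 : R)^'+ (fun de (x : 'rV[R]_d) => forall y : 'rV[R]_d,
  (forall j, `|x ord0 j - y ord0 j| < de) -> `|g x - g y| < e) _) [].
  move=> x Kx.
  have e20 : 0 < e / 2 by rewrite divr_gt0.
  have /cvgrPdist_lt/(_ _ e20)/nbhs_ballP[de /= de0 xde] := gc x.
  exists (ball x (de / 2), [set r | r < de / 2]).
    split; first by apply: nbhsx_ballx; rewrite divr_gt0.
    by apply: nbhs_right_lt; rewrite divr_gt0.
  move=> [x' r] /= [[_ xx'] rde] Kx' y x'y.
  have B1 : `|g x - g x'| < e / 2.
    apply: xde; split=> // i j; rewrite (ord1 i).
    by apply: le_ball (xx' ord0 j); rewrite ler_pdivrMr// ler_peMr// ?ler1n// ltW.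
  have B2 : `|g x - g y| < e / 2.
    apply: xde; split=> // i j; rewrite (ord1 i).
    rewrite (splitr de).
    apply: ball_triangle (xx' ord0 j) _.
    by apply: lt_trans (x'y j) rde.
  rewrite (_ : g x' - g y = (g x - g y) - (g x - g x')); last by ring.
  by rewrite (le_lt_trans (ler_normB _ _))// (splitr e) ltrD.
move=> de /= de0 deP.
exists (de / 2); first by rewrite divr_gt0.
move=> x y Kx xy; apply: (deP (de / 2)) => //.
- by rewrite /ball_ /= sub0r normrN gtr0_norm ?divr_gt0// ltr_pdivrMr// ltr_pMr// ltr1n.
- by rewrite divr_gt0.
Qed.

Section grid.
Variables (R : realType) (N : nat) (delta : R).
Hypothesis delta0 : 0 < delta.

Definition cell_coef (l : nat) (b : bool) : R :=
  if b then 1 else if l == 0%N then 0 else -1.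

(** For [l = 0] there is no lower end: its coefficient in [cell_coef] is 0, and the dummy value
    [delta] keeps every corner strictly positive, as required of the orthants in [portmanteau]. *)
Definition cell_end (l : nat) (b : bool) : R :=
  (if b || (l == 0%N) then l.+1%:R else l%:R) * delta.

(* On [0, oo[ this is the indicator of ]l delta, (l+1) delta], and of
   [0, delta] when l = 0. *)
Definition cell (l : nat) (y : R) : R :=
  \sum_b cell_coef l b * (y <= cell_end l b)%R%:R.

Lemma cell_end_gt0 l b : 0 < cell_end l b.
Proof.
rewrite mulr_gt0//; case: b => //=; case: eqP => //= /eqP.
by rewrite -lt0n ltr0n.
Qed.

Lemma cellE l y : cell l y =
  (y <= l.+1%:R * delta)%R%:R - (if l == 0%N then 0 else (y <= l%:R * delta)%R%:R).
Proof.
rewrite /cell big_bool /cell_coef /cell_end /= mul1r.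
by case: eqP => _; rewrite ?mul0r ?subr0 ?addr0// mulN1r.
Qed.

Lemma cell_ge0 l y : 0 <= cell l y.
Proof.
rewrite cellE subr_ge0; case: eqP => _; first exact: ler0n.
rewrite ler_nat.
case: (boolP (y <= l%:R * delta)) => //= h.
by rewrite (le_trans h)// ler_pM2r// ler_nat.
Qed.

Lemma cell_neq0 l y : 0 <= y -> cell l y != 0 ->
  l%:R * delta <= y <= l.+1%:R * delta.
Proof.
rewrite cellE => y0; case: (boolP (y <= l.+1%:R * delta)) => /= h.
  have [->|_] := eqVneq l 0%N; first by rewrite mul0r y0.
  by case: (leP y) => [|/ltW->]//; rewrite subrr eqxx.
have [_|_] := eqVneq l 0%N; first by rewrite subr0 eqxx.
case: (leP y) => //= h'; last by rewrite subr0 eqxx.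
by move: h; rewrite (le_trans h')// ler_pM2r// ler_nat.
Qed.

Lemma sum_cell y : \sum_(l < N.+1) cell l y = (y <= N.+1%:R * delta)%R%:R.
Proof.
elim: N => [|n IH]; first by rewrite big_ord1 cellE subr0.
by rewrite big_ord_recr /= IH cellE /= addrC subrK.
Qed.

End grid.

(** On each grid cell [g] is replaced by its value at the upper corner. The indicator of a cell is a
    product of one-dimensional differences; expanding it over the choices of an end in each
    coordinate gives a signed sum of orthant indicators. An index is thus a cell with a choice of
    ends. Both sides vanish off the box, so the error carries the indicator of the box. *)
Lemma box_step_approximation (R : realType) (d : nat) (g : 'rV[R]_d -> R)
    (L e : R) : continuous g -> 0 < L -> 0 < e ->
  exists (I : finType) (c : I -> R) (x : I -> 'I_d -> R),
    (forall i j, 0 < x i j) /\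
    forall y : 'rV[R]_d, (forall j, 0 <= y ord0 j) ->
      `|g y * [forall j, (y ord0 j <= L)%R]%:R -
        \sum_i c i * [forall j, (y ord0 j <= x i j)%R]%:R|
      <= e * [forall j, (y ord0 j <= L)%R]%:R.
Proof.
move=> gc L0 e0.
have [de de0 deP] := box_uniform_continuity L gc e0.
have [N LN] : exists N : nat, L / N.+1%:R < de.
  exists (Num.truncn (L / de)); rewrite ltr_pdivrMr// mulrC -ltr_pdivrMr//.
  exact: truncnS_gt.
set h := L / N.+1%:R in LN.
have h0 : 0 < h by rewrite divr_gt0.
have hL : N.+1%:R * h = L by rewrite mulrC divfK.
pose pt (c : {ffun 'I_d -> 'I_N.+1}) : 'rV[R]_d := \row_j ((c j).+1%:R * h).
exists ({ffun 'I_d -> 'I_N.+1} * {ffun 'I_d -> bool})%type.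
exists (fun i : {ffun 'I_d -> 'I_N.+1} * {ffun 'I_d -> bool} =>
  g (pt i.1) * \prod_j cell_coef R (i.1 j) (i.2 j)).
exists (fun (i : {ffun 'I_d -> 'I_N.+1} * {ffun 'I_d -> bool}) j => cell_end h (i.1 j) (i.2 j)).
split=> [i j|y y0]; first exact: cell_end_gt0.
have boxE (x : 'I_d -> R) :
    [forall j, (y ord0 j <= x j)%R]%:R = \prod_j (y ord0 j <= x j)%R%:R :> R.
  case: forallP => [h1|/existsNP[j /negP/negbTE hj]].
    by rewrite big1// => j _; rewrite h1.
  by rewrite (bigD1 j)//= hj mul0r.
have boxL : [forall j, (y ord0 j <= L)%R]%:R =
    \sum_(c : {ffun 'I_d -> 'I_N.+1}) \prod_j cell h (c j) (y ord0 j).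
  transitivity (\prod_(j < d) \sum_(l < N.+1) cell h l (y ord0 j)).
    by rewrite boxE; apply: eq_bigr => j _; rewrite sum_cell// hL.
  by rewrite bigA_distr_bigA.
rewrite -(pair_bigA _ (fun c (B : {ffun 'I_d -> bool}) =>
  g (pt c) * \prod_j cell_coef R (c j) (B j) *
   [forall j, (y ord0 j <= cell_end h (c j) (B j))%R]%:R)) /=.
rewrite [X in `|_ - X|](_ : _ = \sum_(c : {ffun 'I_d -> 'I_N.+1})
    g (pt c) * \prod_j cell h (c j) (y ord0 j)); last first.
  apply: eq_bigr => c _.
  rewrite /cell bigA_distr_bigA /= mulr_sumr; apply: eq_bigr => B _.
  by rewrite boxE -mulrA -big_split.
rewrite boxL !mulr_sumr -sumrB.
apply: le_trans (ler_norm_sum _ _ _) _.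
apply: ler_sum => c _; rewrite -mulrBl normrM.
have p0 : 0 <= \prod_j cell h (c j) (y ord0 j).
  by apply: prodr_ge0 => j _; exact: cell_ge0.
rewrite (ger0_norm p0).
have [->|pn0] := eqVneq (\prod_j cell h (c j) (y ord0 j)) 0; first by rewrite !mulr0.
rewrite ler_wpM2r// ltW// deP// => j.
  have /prodf_neq0/(_ j isT) cn0 := pn0.
  have /andP[_ yj] := cell_neq0 h0 (y0 j) cn0.
  by rewrite y0 /= (le_trans yj)// -hL ler_pM2r// ler_nat.
have /prodf_neq0/(_ j isT) cn0 := pn0.
have /andP[yj1 yj2] := cell_neq0 h0 (y0 j) cn0.
rewrite mxE distrC ger0_norm ?subr_ge0//.
apply: le_lt_trans LN; rewrite lerBlDr (le_trans _ (lerD (lexx _) yj1))//.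
by rewrite -natr1 mulrDl mul1r addrC.
Qed.

(** * Weighted integrals and weak convergence *)

Section Rintegral_lemmas.
Variables (R : realType) (d : measure_display) (T : measurableType d).
Variable mu : {measure set T -> \bar R}.

Lemma Rintegral_dominated_cvg (f_ : nat -> T -> R) (f g : T -> R) :
  (forall n, measurable_fun setT (f_ n)) ->
  (forall x, f_ ^~ x @ \oo --> f x) ->
  mu.-integrable setT (EFin \o g) ->
  (forall n x, `|f_ n x| <= g x) ->
  (fun n => \int[mu]_x f_ n x) @ \oo --> \int[mu]_x f x.
Proof.
move=> mf_ f_f ig f_g.
have mf : measurable_fun setT f by apply: measurable_fun_cvg => // x _; exact: f_f.
have [] := @dominated_convergence _ _ _ mu setT measurableT
  (fun n x => (f_ n x)%:E) (EFin \o f) (EFin \o g).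
- by move=> n; exact/measurable_EFinP.
- exact/measurable_EFinP.
- by apply/aeW => x _; apply: cvg_EFin; [exact: nearW|exact: f_f].
- exact: ig.
- by apply/aeW => x n _; rewrite /= lee_fin.
move=> if_ _ cvf; apply: fine_cvg; rewrite /Rintegral fineK//.
exact: integrable_fin_num.
Qed.

Lemma integrable_bounded_mul (f rho : T -> R) (M : R) : measurable_fun setT f ->
  (forall x, `|f x| <= M) -> mu.-integrable setT (EFin \o rho) ->
  mu.-integrable setT (EFin \o (fun x => f x * rho x)).
Proof.
move=> mf fM irho.
apply: eq_integrable (integrableMr measurableT mf _ irho) => //.
by exists M; split; [exact: num_real|move=> y My x _; exact: le_trans (ltW My)].
Qed.

Lemma Rintegral_sum (I : finType) (f : I -> T -> R) :
  (forall i, mu.-integrable setT (EFin \o f i)) ->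
  \int[mu]_x (\sum_i f i x) = \sum_i \int[mu]_x f i x.
Proof.
move=> fi.
suff [] : mu.-integrable setT (EFin \o (fun x => \sum_i f i x)) /\
  \int[mu]_x (\sum_i f i x) = \sum_i \int[mu]_x f i x by [].
elim: (index_enum I) => [|i s [IH1 IH2]].
  rewrite big_nil; under eq_Rintegral do rewrite big_nil.
  split; last by rewrite Rintegral_cst// mul0r.
  by apply: eq_integrable (integrable0 _ _) => // x _; rewrite /= big_nil.
rewrite big_cons -IH2 -RintegralD//; split.
  apply: eq_integrable (integrableD _ (fi i) IH1) => // x _.
  by rewrite /= big_cons.
by apply: eq_Rintegral => x _; rewrite big_cons.
Qed.

End Rintegral_lemmas.

Section weighted_integral.
Variables (R : realType) (D : nat).
Implicit Types (g : 'rV[R]_D -> R) (x : 'I_D -> R).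

Definition orthant x : 'rV[R]_D -> R := fun y => [forall j, (y ord0 j <= x j)%R]%:R.

Lemma orthant_norm x y : `|orthant x y| <= 1.
Proof. by rewrite /orthant normr_nat lern1; case: [forall _, _]. Qed.

Section one_measure.
Variables (d : measure_display) (O : measurableType d).
Variables (mu : {measure set O -> \bar R}) (rho : O -> R) (X : O -> 'rV[R]_D).
Hypothesis rho0 : forall w, 0 <= rho w.
Hypothesis rho_int : mu.-integrable setT (EFin \o rho).
Hypothesis X0 : forall w j, 0 <= X w ord0 j.
Hypothesis mX : forall j, measurable_fun setT (fun w => X w ord0 j).

(** The integral under the measure with density [rho], whose mass need not be 1: it serves both the
    unnormalised exceedance laws and the limit law on a product with Lebesgue measure. *)
Definition wint (f : O -> R) : R := \int[mu]_w (f w * rho w).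

Lemma measurable_orthant x : measurable_fun setT (orthant x \o X).
Proof.
rewrite (_ : _ \o _ = \1_(\bigcap_(j : 'I_D) [set w | X w ord0 j <= x j])).
  apply: measurable_indic; apply: fin_bigcap_measurable => // j _.
  rewrite -[X in measurable X]setTI.
  rewrite (_ : [set w | _] = (fun w => X w ord0 j) @^-1` `]-oo, x j]%classic).
    exact: mX.
  by apply/seteqP; split=> w /=; rewrite in_itv.
apply/funext => w; rewrite /orthant indicE /=; congr (nat_of_bool _)%:R.
apply/forallP/idP => [h|]; first by rewrite inE => j _; exact: h.
by rewrite inE => h j; exact: h.
Qed.

(** A pointwise limit of step functions of [X]: the [n]-th is within [1 / (n + 1)] of [g] on the box
    of side [n + 1], and each point lies in all large boxes. *)
Lemma measurable_continuous_comp g : continuous g -> measurable_fun setT (g \o X).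
Proof.
move=> gc.
have /choice[h hP] : forall n : nat, exists h : O -> R, measurable_fun setT h /\
    forall w, `|g (X w) * orthant (fun=> n.+1%:R) (X w) - h w| <= n.+1%:R^-1.
  move=> n; have n0 : (0 : R) < n.+1%:R by [].
  have n0' : (0 : R) < n.+1%:R^-1 by rewrite invr_gt0.
  have [I [c [x [x0 H]]]] := box_step_approximation gc n0 n0'.
  exists (fun w => \sum_i c i * orthant (x i) (X w)); split.
    apply: measurable_sum => i; apply: measurable_funM => //.
    exact: measurable_orthant.
  move=> w; apply: le_trans (H (X w) (X0 w)) _.
  by rewrite ler_piMr// ?invr_ge0// ?lern1; case: [forall _, _].
apply: (@measurable_fun_cvg _ _ _ _ h) => [n|w _]; first by case: (hP n).
apply/cvgrPdist_lt => e e0.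
(* One [N] serves accuracy and box alike: the sum of the nonnegative coordinates bounds each of
   them. *)
have [N NP] : exists N : nat, e^-1 < N.+1%:R /\ forall j, X w ord0 j <= N.+1%:R.
  exists (Num.truncn (e^-1 + \sum_j X w ord0 j)).
  have := truncnS_gt (e^-1 + \sum_j X w ord0 j) => hN.
  have s0 : 0 <= \sum_j X w ord0 j by apply: sumr_ge0.
  split; first by apply: le_lt_trans hN; rewrite lerDl.
  move=> j; apply/ltW; apply: le_lt_trans hN.
  rewrite (bigD1 j)//= addrCA lerDl addr_ge0 ?invr_ge0 ?(ltW e0)//.
  exact: sumr_ge0.
exists N => // n /= Nn.
have := (hP n).2 w; rewrite /orthant (_ : [forall _, _] = true) ?mulr1; last first.
  by apply/forallP => j; rewrite (le_trans (NP.2 j))// ler_nat ltnS.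
move/le_lt_trans; apply; rewrite invf_plt ?posrE//.
by rewrite (lt_le_trans NP.1)// ler_nat ltnS.
Qed.

Lemma wint_integrable (f : O -> R) M : measurable_fun setT f ->
  (forall w, `|f w| <= M) -> mu.-integrable setT (EFin \o (fun w => f w * rho w)).
Proof. by move=> mf fM; exact: (integrable_bounded_mul mf fM). Qed.

(** Inside the box the step function is within [e] of [g]; outside it is 0 and [g] is bounded by
    [Mg]. The escaping mass is written as total mass minus the mass of an orthant, two quantities
    whose convergence [portmanteau] assumes. *)
Lemma wint_step_approximation g Mg e (L : R) (I : finType) (c : I -> R)
    (x : I -> 'I_D -> R) : continuous g -> (forall y, `|g y| <= Mg) -> 0 < e ->
  (forall y : 'rV[R]_D, (forall j, 0 <= y ord0 j) ->
      `|g y * orthant (fun=> L) y - \sum_i c i * orthant (x i) y|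
      <= e * orthant (fun=> L) y) ->
  `|wint (g \o X) - \sum_i c i * wint (orthant (x i) \o X)| <=
  e * wint (fun=> 1) + Mg * (wint (fun=> 1) - wint (orthant (fun=> L) \o X)).
Proof.
move=> gc gM e0 H.
have Mg0 : 0 <= Mg by exact: le_trans (gM 0).
have mg := measurable_continuous_comp gc.
have i1 : mu.-integrable setT (EFin \o (fun w => 1 * rho w)).
  by apply: (@wint_integrable (fun=> 1) 1) => // w; rewrite normr1.
have io z : mu.-integrable setT (EFin \o (fun w => orthant z (X w) * rho w)).
  by apply: (@wint_integrable _ 1); [exact: measurable_orthant|move=> w; exact: orthant_norm].
have ig : mu.-integrable setT (EFin \o (fun w => g (X w) * rho w)).
  by apply: (@wint_integrable _ Mg) => // w; exact: gM.
have is_ i : mu.-integrable setT (EFin \o (fun w => c i * (orthant (x i) (X w) * rho w))).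
  by apply: eq_integrable (integrableZl measurableT (c i) (io (x i))) => // w _.
have iS : mu.-integrable setT
    (EFin \o (fun w => \sum_i c i * (orthant (x i) (X w) * rho w))).
  apply: eq_integrable (integrable_sum measurableT (index_enum I) (fun i _ => is_ i)) => //.
  by move=> w _; rewrite /= sumEFin.
have -> : \sum_i c i * wint (orthant (x i) \o X) =
    \int[mu]_w \sum_i c i * (orthant (x i) (X w) * rho w).
  rewrite Rintegral_sum//; apply: eq_bigr => i _.
  by rewrite /wint RintegralZl.
rewrite /wint -(RintegralB measurableT ig iS).
apply: le_trans (le_normr_Rintegral measurableT _) _.
  by apply: eq_integrable (integrableB measurableT ig iS) => // w _.
have ib : mu.-integrable setT
    (EFin \o (fun w => 1 * rho w - orthant (fun=> L) (X w) * rho w)).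
  by apply: eq_integrable (integrableB measurableT i1 (io (fun=> L))) => // w _.
rewrite -(RintegralB measurableT i1 (io (fun=> L))).
rewrite -(RintegralZl e measurableT i1) -(RintegralZl Mg measurableT ib).
have ie : mu.-integrable setT (EFin \o (fun w => e * (1 * rho w))).
  by apply: eq_integrable (integrableZl measurableT e i1) => // w _.
have iM : mu.-integrable setT
    (EFin \o (fun w => Mg * (1 * rho w - orthant (fun=> L) (X w) * rho w))).
  by apply: eq_integrable (integrableZl measurableT Mg ib) => // w _.
rewrite -(RintegralD measurableT ie iM).
apply: le_Rintegral => //.
- apply: integrable_norm.
  by apply: eq_integrable (integrableB measurableT ig iS) => // w _.
- by apply: eq_integrable (integrableD measurableT ie iM) => // w _.
move=> w _.
have -> : g (X w) * rho w - \sum_i c i * (orthant (x i) (X w) * rho w) =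
    ((g (X w) * orthant (fun=> L) (X w) - \sum_i c i * orthant (x i) (X w)) +
     g (X w) * (1 - orthant (fun=> L) (X w))) * rho w.
  rewrite mulrDl mulrBl mulr_suml.
  under [in RHS]eq_bigr do rewrite -mulrA.
  by ring.
rewrite normrM (ger0_norm (rho0 w)) [leRHS](_ : _ =
  (e + Mg * (1 - orthant (fun=> L) (X w))) * rho w); last by ring.
rewrite ler_wpM2r// (le_trans (ler_normD _ _))// lerD//.
  apply: le_trans (H _ (X0 w)) _; rewrite ler_piMr ?(ltW e0)//.
  exact: le_trans (ler_norm _) (orthant_norm _ _).
have o1 : 0 <= 1 - orthant (fun=> L) (X w).
  by rewrite subr_ge0 (le_trans (ler_norm _) (orthant_norm _ _)).
by rewrite normrM (ger0_norm o1) ler_wpM2r.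
Qed.

Lemma wint_box_cvg :
  (fun n : nat => wint (orthant (fun=> n.+1%:R) \o X)) @ \oo --> wint (fun=> 1).
Proof.
apply: (@Rintegral_dominated_cvg _ _ _ mu _ _ rho) => //.
- move=> n; apply: measurable_funM; first exact: measurable_orthant.
  exact/measurable_EFinP/(measurable_int _ rho_int).
- move=> w; apply: cvgMl; apply: cvg_near_cst.
  exists (Num.truncn (\sum_j X w ord0 j)) => // n /= hn.
  rewrite /orthant (_ : [forall _, _] = true)//; apply/forallP => j.
  apply: (@le_trans _ _ (\sum_j X w ord0 j)).
    by rewrite (bigD1 j)//= lerDl sumr_ge0.
  by rewrite (le_trans (ltW (truncnS_gt _)))// ler_nat ltnS.
- move=> n w; rewrite /= normrM (ger0_norm (rho0 w)) ler_piMl//.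
  exact: orthant_norm.
Qed.

End one_measure.

(** Tightness is contained in the two convergences: the box is chosen for the limit measure, and the
    mass outside it converges along the sequence, so one box and one step function work for all
    large [n]. *)
Lemma portmanteau
    (d1 d2 : measure_display) (O1 : measurableType d1) (O2 : measurableType d2)
    (mu1 : {measure set O1 -> \bar R}) (mu2 : {measure set O2 -> \bar R})
    (rho1 : nat -> O1 -> R) (rho2 : O2 -> R)
    (X : nat -> O1 -> 'rV[R]_D) (Y : O2 -> 'rV[R]_D) g (M : R) :
  (forall n w, 0 <= rho1 n w) -> (forall w, 0 <= rho2 w) ->
  (forall n, mu1.-integrable setT (EFin \o rho1 n)) ->
  mu2.-integrable setT (EFin \o rho2) ->
  (forall n w j, 0 <= X n w ord0 j) -> (forall w j, 0 <= Y w ord0 j) ->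
  (forall n j, measurable_fun setT (fun w => X n w ord0 j)) ->
  (forall j, measurable_fun setT (fun w => Y w ord0 j)) ->
  (fun n => wint mu1 (rho1 n) (fun=> 1)) @ \oo --> wint mu2 rho2 (fun=> 1) ->
  (forall x, (forall j, 0 < x j) ->
    (fun n => wint mu1 (rho1 n) (orthant x \o X n)) @ \oo -->
    wint mu2 rho2 (orthant x \o Y)) ->
  continuous g -> (forall y, `|g y| <= M) ->
  (fun n => wint mu1 (rho1 n) (g \o X n)) @ \oo --> wint mu2 rho2 (g \o Y).
Proof.
move=> r1 r2 ir1 ir2 X0 Y0 mX mY c1 co gc gM.
apply/cvgrPdist_lt => e e0.
pose m := wint mu2 rho2 (fun=> 1).
have M0 : 0 <= M by exact: le_trans (gM 0).
have m0 : 0 <= m by apply: Rintegral_ge0 => w _; rewrite mul1r.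
(* The shift from [m] to [m + 1] keeps the denominator positive when [m = 0]. *)
pose e' := e / (4 * (m + 1)).
have e'0 : 0 < e' by rewrite divr_gt0// mulr_gt0// ltr_wpDl.
have he : e' * m < e / 3.
  apply: (@le_lt_trans _ _ (e' * (m + 1))); first by rewrite ler_pM2l// lerDl.
  rewrite /e' invfM mulrA divfK; last by rewrite gt_eqF// ltr_wpDl.
  by rewrite ltr_pM2l// ltf_pV2 ?posrE// ltr_nat.
have [n0 hL] : exists n0 : nat,
    e' * m + M * (m - wint mu2 rho2 (orthant (fun=> n0.+1%:R) \o Y)) < e / 3.
  have : (fun n : nat => e' * m +
      M * (m - wint mu2 rho2 (orthant (fun=> n.+1%:R) \o Y))) @ \oo --> e' * m + M * (m - m).
    apply: cvgD; first exact: cvg_cst.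
    apply: cvgMr; apply: cvgB; [exact: cvg_cst|exact: wint_box_cvg].
  rewrite subrr mulr0 addr0 => /cvgr_lt/(_ _ he)[N _ NP].
  by exists N; apply: NP => /=.
set L : R := n0.+1%:R in hL.
have [I [c [x [x0 H]]]] := box_step_approximation gc (ltr0Sn _ n0 : 0 < L) e'0.
have A2 := wint_step_approximation r2 ir2 Y0 mY gc gM e'0 H.
have cB : (fun n => e' * wint mu1 (rho1 n) (fun=> 1) + M *
    (wint mu1 (rho1 n) (fun=> 1) - wint mu1 (rho1 n) (orthant (fun=> L) \o X n)))
    @ \oo --> e' * m + M * (m - wint mu2 rho2 (orthant (fun=> L) \o Y)).
  apply: cvgD; first by apply: cvgMr.
  by apply: cvgMr; apply: cvgB => //; apply: co.
have cS : (fun n => \sum_i c i * wint mu1 (rho1 n) (orthant (x i) \o X n)) @ \oo -->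
    \sum_i c i * wint mu2 rho2 (orthant (x i) \o Y).
  apply: cvg_big => [|i _]; first exact: add_continuous.
  by apply: cvgMr; apply: co.
have e3 : 0 < e / 3 by rewrite divr_gt0.
move/cvgr_lt/(_ _ hL) : cB => cB; move/cvgrPdist_lt/(_ _ e3) : cS => cS.
near=> n.
have A1 := wint_step_approximation (r1 n) (ir1 n) (X0 n) (mX n) gc gM e'0 H.
have B1 : e' * wint mu1 (rho1 n) (fun=> 1) + M * (wint mu1 (rho1 n) (fun=> 1) -
  wint mu1 (rho1 n) (orthant (fun=> L) \o X n)) < e / 3 by near: n.
have B2 : `|\sum_i c i * wint mu2 rho2 (orthant (x i) \o Y) -
  \sum_i c i * wint mu1 (rho1 n) (orthant (x i) \o X n)| < e / 3 by near: n.
have := le_lt_trans A1 B1; have := le_lt_trans A2 hL; move: B2.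
rewrite !ltr_norml => /andP[? ?] /andP[? ?] /andP[? ?].
by apply/andP; split; lra.
Unshelve. all: by end_near. Qed.

End weighted_integral.

(** * Probabilities as real numbers *)

Section probability_reals.
Variables (R : realType) (d : measure_display) (O : measurableType d).
Variable (P : probability O R).

Definition pr (A : set O) : R := fine (P A).

Lemma prE A : measurable A -> P A = (pr A)%:E.
Proof. by move=> mA; rewrite /pr fineK// fin_num_measure. Qed.

Lemma pr_ge0 A : 0 <= pr A.
Proof. exact: fine_ge0. Qed.

Lemma prT : pr setT = 1.
Proof. by rewrite /pr probability_setT. Qed.

Lemma pr0 : pr set0 = 0.
Proof. by rewrite /pr measure0. Qed.

Lemma le_pr A B : measurable A -> measurable B -> A `<=` B -> pr A <= pr B.
Proof.
move=> mA mB AB; rewrite -lee_fin -!prE//.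
by apply: le_measure; rewrite ?inE.
Qed.

Lemma pr_le1 A : measurable A -> pr A <= 1.
Proof. by move=> mA; rewrite -prT le_pr. Qed.

Lemma prD A B : measurable A -> measurable B ->
  pr (A `\` B) = pr A - pr (A `&` B).
Proof.
move=> mA mB; apply: EFin_inj; rewrite -prE; last exact: measurableD.
rewrite measureD//; last by rewrite (le_lt_trans (probability_le1 _ mA))// ltry.
by rewrite EFinB -!prE//; exact: measurableI.
Qed.

Lemma prC A : measurable A -> pr (~` A) = 1 - pr A.
Proof. by move=> mA; rewrite -setTD prD// setTI prT. Qed.

Lemma le_prU A B : measurable A -> measurable B ->
  pr (A `|` B) <= pr A + pr B.
Proof.
move=> mA mB; rewrite -lee_fin EFinD -!prE//; last exact: measurableU.
exact: measureU2.
Qed.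

Lemma pr_sum (I : finType) (B : I -> set O) : (forall i, measurable (B i)) ->
  trivIset setT B -> pr (\bigcup_i B i) = \sum_i pr (B i).
Proof.
move=> mB tB; apply: EFin_inj.
have mU : measurable (\bigcup_i B i) by apply: fin_bigcup_measurable => // i _; exact: mB.
rewrite -prE// -sumEFin.
have -> : [set: I] = [set` enum I] by apply/seteqP; split=> x //= _; rewrite mem_enum.
rewrite measure_fin_bigcup//; last exact: sub_trivIset tB.
rewrite -fsbig_seq ?enum_uniq// big_enum /=.
by apply: eq_bigr => i _; rewrite prE.
Qed.

Lemma nondecreasing_cvg_pr (B : nat -> set O) : (forall n, measurable (B n)) ->
  (forall m n, (m <= n)%N -> B m `<=` B n) ->
  (fun n => pr (B n)) @ \oo --> pr (\bigcup_n B n).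
Proof.
move=> mB ndB; apply: fine_cvg.
rewrite -prE; last exact: bigcup_measurable.
apply: nondecreasing_cvg_mu => //; first exact: bigcup_measurable.
by move=> m n mn; apply/subsetPset; exact: ndB.
Qed.

Lemma nonincreasing_cvg_pr (B : nat -> set O) : (forall n, measurable (B n)) ->
  (forall m n, (m <= n)%N -> B n `<=` B m) ->
  (fun n => pr (B n)) @ \oo --> pr (\bigcap_n B n).
Proof.
move=> mB niB; apply: fine_cvg.
rewrite -prE; last exact: bigcapT_measurable.
apply: nonincreasing_cvg_mu => //; last 2 first.
- exact: bigcapT_measurable.
- by move=> m n mn; apply/subsetPset; exact: niB.
by rewrite (le_lt_trans (probability_le1 _ (mB _)))// ltry.
Qed.

Lemma pr_Rintegral A : measurable A -> pr A = \int[P]_w (\1_A w).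
Proof. by move=> mA; rewrite /Rintegral integral_indic// setIT. Qed.

Lemma indep_salgebra (G : set (set O)) (C : set O) : setI_closed G ->
  G `<=` measurable -> measurable C ->
  (forall A, G A -> pr (A `&` C) = pr A * pr C) ->
  forall A, <<s G >> A -> pr (A `&` C) = pr A * pr C.
Proof.
move=> GI Gm mC GC.
pose H := [set A | measurable A /\ pr (A `&` C) = pr A * pr C].
suff : <<s G >> `<=` H by move=> + A GA => /(_ A GA)[].
apply: lambda_system_subset => //; last 1 first.
- by move=> A GA; split; [exact: Gm|exact: GC].
apply/dynkin_lambda_system; split.
- by split=> //; rewrite setTI prT mul1r.
- move=> A [mA AC]; split; first exact: measurableC.
  have := prD mC mA; rewrite setDE setIC => ->.
  by rewrite prC// setIC AC; ring.
- move=> F tF HF; split; first by apply: bigcup_measurable => k _; case: (HF k).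
  have mF k : measurable (F k) by case: (HF k).
  have mU : measurable (\bigcup_k F k) by exact: bigcup_measurable.
  apply: EFin_inj; rewrite EFinM -!prE//; last exact: measurableI.
  rewrite setI_bigcupl measure_bigcup//=; last 2 first.
  + by move=> k _; exact: measurableI.
  + by apply: trivIset_setIr tF.
  rewrite measure_bigcup//= muleC (prE mC) -nneseriesZl//.
  apply: eq_eseriesr => k _.
  rewrite prE; last exact: measurableI.
  by rewrite (HF k).2 (prE (mF k)) EFinM muleC.
Qed.

End probability_reals.

(** * Poisson marking on a geometric grid *)

Section geometric_grid.
Variables (R : realType) (q beta v : R).
Hypotheses (q1 : 1 < q) (beta0 : 0 < beta).

Let q0 : 0 < q. Proof. exact: lt_trans q1. Qed.

Definition grid (l : nat) : R := q ^+ l * beta.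

Lemma grid_gt0 l : 0 < grid l.
Proof. by rewrite mulr_gt0// exprn_gt0. Qed.

Lemma gridS l : grid l.+1 = q * grid l.
Proof. by rewrite /grid exprS mulrA. Qed.

Lemma grid_lt l : grid l < grid l.+1.
Proof. by rewrite gridS ltr_pMl// grid_gt0. Qed.

Lemma grid_homo : {mono grid : l m / (l <= m)%N >-> l <= m}.
Proof.
apply: le_mono; apply: (homo_ltn lt_trans); exact: grid_lt.
Qed.

Lemma gridV_gt l : 0 < (grid l)^-1 - (grid l.+1)^-1.
Proof. by rewrite subr_gt0 ltf_pV2 ?posrE ?grid_gt0// grid_lt. Qed.

(** Each weight is the mass of a cell under [u^-2 du], kept if the upper end of the cell exceeds
    [1 / v]. The lowest kept cell starts above [1 / (q v)] and the masses telescope from there; the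
    maximum with 0 covers the case of no kept cell. *)
Lemma upper_grid_sum M :
  \sum_(l < M) ((grid l)^-1 - (grid l.+1)^-1) * (1 < grid l.+1 * v)%R%:R
  <= Num.max 0 (q * v - (grid M)^-1).
Proof.
elim: M => [|M IH]; first by rewrite big_ord0 le_max lexx.
rewrite big_ord_recr /=; case: (ltP 1 (grid M.+1 * v)) => h.
  rewrite mulr1 le_max; apply/orP; right.
  have hM : (grid M)^-1 <= q * v.
    rewrite -[leLHS]mulr1 mulrC ler_pdivrMr ?grid_gt0//.
    by rewrite ltW// (_ : q * v * grid M = grid M.+1 * v)// gridS; ring.
  move: IH; rewrite max_r ?subr_ge0// => IH.
  by rewrite (le_trans (lerD IH (lexx _)))//; lra.
rewrite mulr0 addr0 (le_trans IH)// ge_max !le_max lexx /=.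
by rewrite [X in _ || X](_ : _ = true) ?orbT//; have := gridV_gt M; lra.
Qed.

(** Now a cell is kept if its lower end exceeds [1 / v]. The lowest kept cell starts at [q / v] or
    below, unless it is the first one, which starts at [beta]; hence the minimum. *)
Lemma lower_grid_sum M :
  Num.min (v / q) beta^-1 - (grid M)^-1 <=
  \sum_(l < M) ((grid l)^-1 - (grid l.+1)^-1) * (1 < grid l * v)%R%:R.
Proof.
elim: M => [|M IH].
  by rewrite big_ord0 /grid expr0 mul1r subr_le0 ge_min lexx orbT.
rewrite big_ord_recr /=; case: (ltP 1 (grid M * v)) => h.
  by rewrite mulr1; lra.
rewrite mulr0 addr0 (@le_trans _ _ 0)//; last first.
  apply: sumr_ge0 => l _; rewrite mulr_ge0 ?ler0n//.
  by have := gridV_gt l; lra.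
rewrite subr_le0 ge_min ler_pdivrMr// gridS invfM mulrAC mulVf ?gt_eqF// mul1r.
by rewrite -[(grid M)^-1]mul1r ler_pdivlMr ?grid_gt0// mulrC h.
Qed.

End geometric_grid.

Section cylinders.
Variables (R : realType) (I : Type) (d : measure_display) (O : measurableType d).
Implicit Types X : I -> O -> R.

Lemma cyl_setI X : setI_closed (cyl X).
Proof.
move=> _ _ [s ->] [s' ->]; exists (s ++ s').
by apply/seteqP; split=> w /=; rewrite all_cat => /andP.
Qed.

Lemma cylT X : cyl X setT.
Proof. by exists [::]; apply/seteqP; split. Qed.

Lemma cyl_le X i x : cyl X [set w | X i w <= x].
Proof. by exists [:: (i, x)]; apply/seteqP; split=> w /=; rewrite andbT. Qed.

Lemma measurable_le (X : O -> R) x : measurable_fun setT X ->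
  measurable [set w | X w <= x].
Proof.
move=> mX; rewrite -[X in measurable X]setTI.
have -> : [set w | X w <= x] = X @^-1` `]-oo, x]%classic.
  by apply/seteqP; split=> w /=; rewrite in_itv.
exact: mX.
Qed.

Lemma cyl_measurable X : (forall i, measurable_fun setT (X i)) ->
  cyl X `<=` measurable.
Proof.
move=> mX _ [s ->]; elim: s => [|[i x] s IH] /=.
  by rewrite (_ : [set _ | _] = setT)//; apply/seteqP; split.
rewrite (_ : [set _ | _] = [set w | X i w <= x] `&`
  [set w | all (fun ix => X ix.1 w <= ix.2) s]); last first.
  by apply/seteqP; split=> w /= => [/andP|] [] => [|->].
by apply: measurableI => //; exact: measurable_le.
Qed.

End cylinders.

(** * Probability that all points in finitely many cells are well marked *)

Section poisson_marking.
Variables (R : realType) (d : measure_display) (O : measurableType d).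
Variables (P : probability O R) (U : nat -> O -> R).
Hypothesis UP : PPP_u2 P U.
Variable C : nat -> set (set O).
Hypothesis Cm : forall i, C i `<=` measurable.
Hypothesis CT : forall i, C i setT.
Hypothesis UC_indep : mutually_indep P
  (fun o : option nat => match o with None => cyl U | Some i => C i end).
Variables (M : nat) (b : nat -> R).
Hypothesis b0 : forall l, 0 < b l.
Hypothesis bS : forall l, b l < b l.+1.
Variables (D : nat -> 'I_M -> set O) (F : 'I_M -> R).
Hypothesis CD : forall i l, C i (D i l).
Hypothesis DF : forall i l, pr P (D i l) = F l.

Let b_mono : {mono b : l m / (l <= m)%N >-> l <= m}.
Proof. by apply: le_mono; exact: (homo_ltn lt_trans). Qed.

Let b_lt l m : (b l < b m) = (l < m)%N.
Proof. by rewrite !ltNge b_mono ltnNge. Qed.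

Definition label (i : nat) (w : O) : option 'I_M :=
  [pick l : 'I_M | b l < U i w <= b l.+1].

Lemma labelP i w l : reflect (label i w = Some l) (b l < U i w <= b l.+1).
Proof.
rewrite /label; case: pickP => [l' /andP[h1 h2]|h]; last first.
  by rewrite h; constructor.
apply: (iffP idP) => [/andP[h3 h4]|[<-]]; last by rewrite h1.
congr Some; apply/val_inj/eqP; rewrite /= eqn_leq.
have := lt_le_trans h1 h4; have := lt_le_trans h3 h2.
by rewrite !b_lt !ltnS => -> ->.
Qed.

Definition marked (i : nat) (o : option 'I_M) : set O :=
  if o is Some l then D i l else setT.

Definition mark_prob (o : option 'I_M) : R := if o is Some l then F l else 1.

Lemma marked_measurable i o : measurable (marked i o).
Proof. by case: o => [l|] //=; apply/Cm/CD. Qed.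

Lemma measurable_label i o : (cyl U).-sigma.-measurable [set w | label i w = o].
Proof.
have h l : (cyl U).-sigma.-measurable [set w | label i w = Some l].
  rewrite (_ : [set _ | _] = [set w | U i w <= b l.+1] `\` [set w | U i w <= b l]).
    by apply: measurableD; apply: sub_sigma_algebra; exact: cyl_le.
  apply/seteqP; split=> w /=.
    by move/labelP/andP => [h1 h2]; split=> //; apply/negP; rewrite -ltNge.
  by move=> [h1 /negP]; rewrite -ltNge => h2; apply/labelP; rewrite h1 h2.
case: o => [l//|].
rewrite (_ : [set _ | _] = ~` \bigcup_(l : 'I_M) [set w | label i w = Some l]).
  by apply/measurableC/fin_bigcup_measurable.
apply/seteqP; split=> w /=; first by move=> lw [l _]; rewrite /= lw.
by move=> nl; case lw: (label i w) => [l|//]; case: nl; exists l.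
Qed.

Lemma pattern_measurable (c : nat -> option 'I_M) :
  (cyl U).-sigma.-measurable [set w | forall i, label i w = c i].
Proof.
rewrite (_ : [set _ | _] = \bigcap_i [set w | label i w = c i]).
  by apply: bigcapT_measurable => i; exact: measurable_label.
by apply/seteqP; split=> w h i; have := h i; [move=> + _; exact|exact].
Qed.

Let cylU_measurable : cyl U `<=` measurable.
Proof. by case: UP => mU _; exact: cyl_measurable. Qed.

Let sigmaU_measurable (A : set O) :
  (cyl U).-sigma.-measurable A -> d.-measurable A.
Proof.
have sub : <<s cyl U >> `<=` @measurable _ O.
  by apply: smallest_sub; [exact: sigma_algebra_measurable|exact: cylU_measurable].
exact: sub.
 Qed.

(** For a cylinder event of [U] this is the assumed independence along the list [None], [Some 0],
    ..., [Some (n - 1)]; [indep_salgebra] extends it to the generated sigma-algebra. A point outside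
    all cells carries the sure event, which [CT] admits. *)
Lemma pr_pattern_marked (n : nat) (c : nat -> option 'I_M) (A : set O) :
  (cyl U).-sigma.-measurable A ->
  pr P (A `&` \big[setI/setT]_(0 <= i < n) marked i (c i)) =
  pr P A * \prod_(0 <= i < n) mark_prob (c i).
Proof.
pose CC := \big[setI/setT]_(0 <= i < n) marked i (c i).
have mC i o : C i (marked i o) by case: o => [l|]; [exact: CD|exact: CT].
have pm i o : pr P (marked i o) = mark_prob o.
  by case: o => [l|] /=; rewrite ?DF ?prT.
have pC : pr P CC = \prod_(0 <= i < n) mark_prob (c i).
  have := @UC_indep (map Some (index_iota 0 n))
    (fun o => if o is Some i then marked i (c i) else setT).
  rewrite !big_map /CC /pr => ->.
  - by apply: eq_bigr => i _; exact: pm.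
  - by rewrite map_inj_uniq /index_iota ?iota_uniq// => i j [].
  - by move=> _ /mapP[i _ ->].
have mCC : measurable CC by apply: bigsetI_measurable => i _; exact: marked_measurable.
move=> mA; rewrite -pC; apply: indep_salgebra mA => //; first exact: cyl_setI.
move=> B cB; rewrite pC.
have := @UC_indep (None :: map Some (index_iota 0 n))
  (fun o => if o is Some i then marked i (c i) else B).
rewrite !big_cons !big_map /CC /pr => ->.
- by congr (_ * _); apply: eq_bigr => i _; exact: pm.
- rewrite /= map_inj_uniq; last by move=> i j [].
  rewrite /index_iota iota_uniq andbT; by apply/mapP => -[].
- by move=> [i|] // _; exact: mC.
Qed.

Definition counts (m : 'I_M -> nat) : set O :=
  [set w | forall l : 'I_M, count_eq U (b l) (b l.+1) (m l) w].

Definition all_marked : set O :=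
  [set w | forall i (l : 'I_M), b l < U i w <= b l.+1 -> D i l w].

Let finite_pattern n (c : {ffun 'I_n -> option 'I_M}) (i : nat) : option 'I_M :=
  if insub i is Some j then c j else None.

Let finite_patternE n (c : {ffun 'I_n -> option 'I_M}) (j : 'I_n) :
  finite_pattern c j = c j.
Proof. by rewrite /finite_pattern valK. Qed.

Let patterns n (m : 'I_M -> nat) (c : {ffun 'I_n -> option 'I_M}) : bool :=
  [forall l, #|[pred j | c j == Some l]| == m l].

Let pattern_event n (c : {ffun 'I_n -> option 'I_M}) : set O :=
  [set w | forall i, label i w = finite_pattern c i].

Let unlabelled_from n : set O := [set w | forall i, (n <= i)%N -> label i w = None].

Let count_eq_pattern n (c : {ffun 'I_n -> option 'I_M}) w (l : 'I_M) m :
  pattern_event c w -> count_eq U (b l) (b l.+1) m w <->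
    #|[pred j | c j == Some l]| = m.
Proof.
move=> cw.
pose s0 := map val (enum [pred j | c j == Some l]).
have us0 : uniq s0 by rewrite map_inj_uniq ?enum_uniq//; exact: val_inj.
have ss0 : size s0 = #|[pred j | c j == Some l]| by rewrite size_map -cardE.
have ms0 i : (b l < U i w <= b l.+1) = (i \in s0).
  apply/labelP/mapP => [|[j]].
    rewrite cw /finite_pattern; case: insubP => // j _ <- cj.
    by exists j => //; rewrite mem_enum inE cj.
  by rewrite mem_enum inE => /eqP cj ->; rewrite cw finite_patternE.
split=> [[s [us <- hs]]|<-].
  rewrite -ss0; apply/perm_size/uniq_perm => // i.
  by rewrite -ms0; apply/idP/idP => /hs.
by exists s0; split=> // i; rewrite ms0.
Qed.

(** If no point of index [n] or more lies in a cell, the counts are decided by the labels of the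
    first [n] points. The event is then a finite disjoint union of patterns. *)
Let counts_unlabelled n m :
  counts m `&` unlabelled_from n =
  \bigcup_(c : {ffun 'I_n -> option 'I_M})
    (if patterns m c then pattern_event c else set0).
Proof.
apply/seteqP; split=> w.
  move=> [cw un].
  pose c : {ffun 'I_n -> option 'I_M} := [ffun j : 'I_n => label j w].
  have wc : pattern_event c w.
    move=> i; rewrite /finite_pattern; case: insubP => [j _ <-|].
      by rewrite ffunE.
    by rewrite -leqNgt; exact: un.
  exists c => //; rewrite ifT//; apply/forallP => l; apply/eqP.
  by apply/(count_eq_pattern l _ wc); exact: cw.
move=> [c _]; case: ifP => // /forallP cm wc; split.
  by move=> l; apply/(count_eq_pattern l _ wc)/eqP.
move=> i ni; rewrite wc /finite_pattern; case: insubP => // j.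
by rewrite ltnNge ni.
Qed.

Let pattern_event_measurable n (c : {ffun 'I_n -> option 'I_M}) :
  measurable (pattern_event c).
Proof. by apply: sigmaU_measurable; exact: pattern_measurable. Qed.

Let pattern_trivIset n m : trivIset setT (fun c : {ffun 'I_n -> option 'I_M} =>
  if patterns m c then pattern_event c else set0).
Proof.
move=> c c' _ _ [w []]; case: ifP => // _ wc; case: ifP => // _ wc'.
by apply/ffunP => j; rewrite -!finite_patternE -wc -wc'.
Qed.

Let counts_unlabelled_measurable n m : measurable (counts m `&` unlabelled_from n).
Proof.
rewrite counts_unlabelled; apply: fin_bigcup_measurable => // c _.
by case: ifP.
Qed.

(** Finite counts in finitely many cells leave a last labelled index. *)
Let counts_cvg m : \bigcup_n (counts m `&` unlabelled_from n) = counts m.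
Proof.
rewrite -setI_bigcupr; apply/setIidl => w cw.
have /choice[f fP] : forall l : 'I_M, exists n, forall i, (n <= i)%N ->
    ~~ (b l < U i w <= b l.+1).
  move=> l; have [s [_ _ hs]] := cw l.
  exists (\max_(i <- s) i).+1 => i; apply: contraTN => /hs iS.
  by rewrite -leqNgt; exact: leq_bigmax_seq.
exists (\max_l f l) => // i ni.
case h : (label i w) => [l|//]; move/labelP : h.
by rewrite (negbTE (fP l i _))// (leq_trans _ ni)//; exact: leq_bigmax.
Qed.

Lemma counts_measurable m : measurable (counts m).
Proof. by rewrite -counts_cvg; exact: bigcup_measurable. Qed.

Let all_marked_pattern n (c : {ffun 'I_n -> option 'I_M}) :
  all_marked `&` pattern_event c = pattern_event c `&`
    \big[setI/setT]_(0 <= i < n) marked i (finite_pattern c i).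
Proof.
rewrite -bigcap_seq setIC; apply/seteqP; split=> w [wc h]; split=> //.
  move=> i /= _; rewrite -wc; case hl : (label i w) => [l|//] /=.
  by apply: h; apply/labelP.
move=> i l /labelP hl; have := h i; rewrite /= -wc hl /=; apply.
rewrite mem_index_iota /=; move: hl; rewrite wc /finite_pattern.
by case: insubP => // j.
Qed.

Lemma all_marked_measurable : measurable all_marked.
Proof.
rewrite (_ : all_marked = \bigcap_i \bigcap_(l : 'I_M)
    (~` [set w | label i w = Some l] `|` D i l)).
  apply: bigcapT_measurable => i; apply: fin_bigcap_measurable => // l _.
  apply: measurableU; last exact/Cm/CD.
  by apply: measurableC; apply: sigmaU_measurable; exact: measurable_label.
apply/seteqP; split=> w h i.
  move=> _ l _; have [/labelP hl|] := boolP (b l < U i w <= b l.+1).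
    by right; apply: h; apply/labelP.
  by move=> /labelP; left.
by move=> l /labelP hl; have [|//] := h i I l I.
Qed.

(** A point of cell [l] is well marked with probability [F l] whatever its index, so all patterns
    with counts [m] share one factor. It leaves the finite sum over patterns, and then [n] grows. *)
Lemma pr_all_marked_counts m :
  pr P (all_marked `&` counts m) = pr P (counts m) * \prod_l F l ^+ m l.
Proof.
pose cst := \prod_l F l ^+ m l.
have H n : pr P (all_marked `&` (counts m `&` unlabelled_from n)) =
    pr P (counts m `&` unlabelled_from n) * cst.
  have mp (c : {ffun 'I_n -> option 'I_M}) :
      measurable (if patterns m c then pattern_event c else set0) by case: ifP.
  rewrite counts_unlabelled setI_bigcupr pr_sum; last 2 first.
  - by move=> c; apply: measurableI => //; exact: all_marked_measurable.
  - exact/trivIset_setIl/pattern_trivIset.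
  rewrite pr_sum//; last exact: pattern_trivIset.
  rewrite mulr_suml; apply: eq_bigr => c _; case: ifP => [/forallP cm|_]; last first.
    by rewrite setI0 pr0 mul0r.
  rewrite all_marked_pattern pr_pattern_marked; last exact: pattern_measurable.
  congr (_ * _); rewrite big_mkord.
  (* A product over points becomes a product over cells: each point contributes only to the cell of
     its label. *)
  transitivity (\prod_(j < n) \prod_l (if c j == Some l then F l else 1)).
    apply: eq_bigr => j _; rewrite finite_patternE /mark_prob.
    case: (c j) => [l|]; last by rewrite big1.
    rewrite (bigD1 l)//= eqxx big1 ?mulr1// => l' l'l.
    by case: eqP => // -[ll']; rewrite ll' eqxx in l'l.
  rewrite exchange_big /=; apply: eq_bigr => l _.
  by rewrite -big_mkcond prodr_const -(eqP (cm l)).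
have mono n n' : (n <= n')%N -> unlabelled_from n `<=` unlabelled_from n'.
  by move=> nn' w h i ni; apply: h; exact: leq_trans ni.
have cv1 : (fun n => pr P (counts m `&` unlabelled_from n)) @ \oo --> pr P (counts m).
  rewrite -[X in _ --> pr P X]counts_cvg; apply: nondecreasing_cvg_pr => //.
  by move=> n n' nn'; apply: setIS; exact: mono.
have cv2 : (fun n => pr P (all_marked `&` (counts m `&` unlabelled_from n))) @ \oo -->
    pr P (all_marked `&` counts m).
  rewrite -[X in _ --> pr P (_ `&` X)]counts_cvg setI_bigcupr.
  apply: nondecreasing_cvg_pr => [n|n n' nn'].
    by apply: measurableI => //; exact: all_marked_measurable.
  by do 2 apply: setIS; exact: mono.
apply: cvg_unique cv2 _ => //.
rewrite (_ : (fun n => _) = (fun n => pr P (counts m `&` unlabelled_from n) * cst)).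
  by apply: cvgMl.
by apply/funext => n.
Qed.

Definition poisson_pmf (mu : R) (k : nat) : R := expR (- mu) * mu ^+ k / (k`!)%:R.

(** The mass of a cell under [u^-2 du]. *)
Definition intensity (l : nat) : R := (b l)^-1 - (b l.+1)^-1.

Lemma intensity_ge0 l : 0 <= intensity l.
Proof. by rewrite subr_ge0 lef_pV2 ?posrE// ltW. Qed.

Lemma pr_counts m : pr P (counts m) = \prod_(l < M) poisson_pmf (intensity l) (m l).
Proof.
have [s sE] : exists s, s = enum 'I_M by exists (enum 'I_M).
case: UP => _ [_ /(_ [seq ((b (l : 'I_M), b l.+1), m l) | l <- s])].
rewrite !big_map => H.
have -> : \prod_(l < M) poisson_pmf (intensity l) (m l) =
  \prod_(l <- s) poisson_pmf (intensity l) (m l) by rewrite sE big_enum.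
rewrite {}sE in H *.
rewrite -[RHS]H; last 2 first.
- by apply/allP => _ /mapP[l _ ->] /=; rewrite b0 bS.
- rewrite pairwise_map.
  apply: (@sub_pairwise _ (relpre val ltn)) => [l l' /= ll'|].
    by rewrite b_mono ll'.
  rewrite -pairwise_map val_enum_ord -sorted_pairwise ?iota_ltn_sorted//.
  exact: ltn_trans.
congr (fine (P _)); rewrite -bigcap_seq.
apply/seteqP; split=> w h; first by move=> l _; exact: h.
by move=> l; apply: h; rewrite /= mem_enum.
Qed.

Lemma counts_trivIset (K : nat) : trivIset setT
  (fun m : {ffun 'I_M -> 'I_K} => counts (fun l => m l)).
Proof.
move=> m m' _ _ [w [h h']]; apply/ffunP => l; apply/val_inj => /=.
have [s [us <- hs]] := h l; have [s' [us' <- hs']] := h' l.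
apply/perm_size/uniq_perm => // i.
by apply/idP/idP => [/hs/hs'|/hs'/hs].
Qed.

Lemma poisson_pgf_cvg (mu z : R) :
  (fun K => \sum_(k < K) poisson_pmf mu k * z ^+ k) @ \oo -->
  expR (- (mu * (1 - z))).
Proof.
rewrite (_ : - _ = - mu + mu * z); last by ring.
rewrite expRD (_ : (fun K => _) =
    (fun K => expR (- mu) * series (exp_coeff (mu * z)) K)).
  by apply: cvgMr; exact: is_cvg_series_exp_coeff.
apply/funext => K; rewrite /series /= big_mkord mulr_sumr.
apply: eq_bigr => k _; rewrite /poisson_pmf /exp_coeff /= exprMn.
by rewrite -!mulrA; congr (_ * (_ * _)); rewrite mulrC.
Qed.

(** Summing over the counts gives, in each cell, the Poisson generating function at [F l]. Counts
    are cut below [K] so that the sums stay finite and factor over the cells. *)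
Lemma pr_all_marked :
  pr P all_marked = expR (- \sum_(l < M) intensity l * (1 - F l)).
Proof.
pose S (z : 'I_M -> R) K := \prod_(l < M)
  \sum_(k < K) poisson_pmf (intensity l) k * z l ^+ k.
have SE z K : S z K = \sum_(m : {ffun 'I_M -> 'I_K})
    pr P (counts (fun l => m l)) * \prod_l z l ^+ m l.
  rewrite /S bigA_distr_bigA; apply: eq_bigr => m _.
  by rewrite pr_counts -big_split.
have S_cvg z : S z @ \oo --> expR (- \sum_(l < M) intensity l * (1 - z l)).
  rewrite -sumrN expR_sum; apply: cvg_big => [|l _]; first exact: mul_continuous.
  exact: poisson_pgf_cvg.
(* At [z = 1] the sums are the probabilities of the truncated count events; their limit 1 makes the
   loss by truncation vanish in [SG]. *)
have S1 : S (fun=> 1) @ \oo --> (1 : R).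
  have := S_cvg (fun=> 1); rewrite big1 ?oppr0 ?expR0// => l _.
  by rewrite subrr mulr0.
have mU K : measurable (\bigcup_(m : {ffun 'I_M -> 'I_K}) counts (fun l => m l)).
  by apply: fin_bigcup_measurable => // m _; exact: counts_measurable.
have lo K : S F K = pr P (all_marked `&`
    \bigcup_(m : {ffun 'I_M -> 'I_K}) counts (fun l => m l)).
  rewrite SE setI_bigcupr pr_sum; last 2 first.
  - by move=> m; apply: measurableI;
      [exact: all_marked_measurable|exact: counts_measurable].
  - exact/trivIset_setIl/counts_trivIset.
  by apply: eq_bigr => m _; rewrite pr_all_marked_counts.
have hi K : S (fun=> 1) K =
    pr P (\bigcup_(m : {ffun 'I_M -> 'I_K}) counts (fun l => m l)).
  rewrite SE pr_sum; last 2 first.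
  - by move=> m; exact: counts_measurable.
  - exact: counts_trivIset.
  by apply: eq_bigr => m _; rewrite big1 ?mulr1// => l _; rewrite expr1n.
have SG : S F @ \oo --> pr P all_marked.
  apply: (@squeeze_cvgr _ _ _ _ (fun K => pr P all_marked - (1 - S (fun=> 1) K))
    (fun=> pr P all_marked)); last exact: cvg_cst.
  - apply: nearW => K; rewrite lo hi; apply/andP; split.
      rewrite lerBlDr -lerBlDl -prC// -prD//; last exact: all_marked_measurable.
      apply: le_pr; last by move=> w [].
        by apply: measurableD => //; exact: all_marked_measurable.
      exact: measurableC.
    apply: le_pr; last by move=> w [].
      by apply: measurableI => //; exact: all_marked_measurable.
    exact: all_marked_measurable.
  - rewrite -[X in _ --> X]subr0 -[X in _ --> _ - X](subrr 1).
    by apply: cvgB; [exact: cvg_cst|apply: cvgB => //; exact: cvg_cst].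
exact: cvg_unique SG (S_cvg F).
Qed.

End poisson_marking.

Lemma grid_cell (R : realType) (q beta u : R) (M : nat) :
  grid q beta 0 < u <= grid q beta M ->
  exists l : 'I_M, grid q beta l < u <= grid q beta l.+1.
Proof.
elim: M => [|M IH] /andP[h1 h2]; first by have := lt_le_trans h1 h2; rewrite ltxx.
have [h|h] := leP u (grid q beta M); last by exists ord_max; rewrite h h2.
have [|l hl] := IH; first by rewrite h1.
by exists (widen_ord (leqnSn M) l).
Qed.

(** * Distribution of the maximum of the marked points *)

Section poisson_maximum.
Variables (R : realType) (d : measure_display) (O : measurableType d).
Variables (P : probability O R) (U : nat -> O -> R).
Hypothesis UP : PPP_u2 P U.
Variable C : nat -> set (set O).
Hypothesis Cm : forall i, C i `<=` measurable.
Hypothesis CT : forall i, C i setT.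
Hypothesis UC_indep : mutually_indep P
  (fun o : option nat => match o with None => cyl U | Some i => C i end).
Variables (W : nat -> O -> R) (W0 : O -> R).
Hypothesis mW : forall i, measurable_fun setT (W i).
Hypothesis W_ge0 : forall i w, 0 <= W i w.
Hypothesis CW : forall i y, 0 < y -> C i [set w | W i w <= y].
Hypothesis W0_ge0 : forall w, 0 <= W0 w.
Hypothesis W0_int : P.-integrable setT (EFin \o W0).
Hypothesis WW0 : forall i y, 0 < y ->
  pr P [set w | W i w <= y] = pr P [set w | W0 w <= y].
Variable x : R.
Hypothesis x0 : 0 < x.

Let e := (\int[P]_w W0 w) / x.

Let mW0 : measurable_fun setT W0.
Proof. exact/measurable_EFinP/(measurable_int _ W0_int). Qed.

(** A point [u] with mark [W0 w] exceeds the bound [x] exactly when [1 < u * v w]. *)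
Let v w := W0 w / x.

Let v_ge0 w : 0 <= v w. Proof. by rewrite divr_ge0// ltW. Qed.

Let mv : measurable_fun setT v.
Proof. exact: measurable_funM. Qed.

Let iv : P.-integrable setT (EFin \o v).
Proof.
apply: eq_integrable (integrableZr measurableT x^-1 W0_int) => // w _.
Qed.

Let ev : \int[P]_w v w = e.
Proof. by rewrite /v RintegralZr. Qed.

Section ratio.
Variable q : R.
Hypothesis q1 : 1 < q.

Let q0 : 0 < q. Proof. exact: lt_trans q1. Qed.

(** With [r + r] cells this grid runs from [q ^- r] to [q ^+ r] and exhausts the half-line as [r]
    grows. *)
Let gr (r : nat) := grid q (q ^- r).

Let beta0 r : 0 < q ^- r. Proof. by rewrite invr_gt0 exprn_gt0. Qed.

Let gr_gt0 r l : 0 < gr r l. Proof. exact: grid_gt0. Qed.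

Let gr0 r : gr r 0 = q ^- r. Proof. by rewrite /gr /grid expr0 mul1r. Qed.

Let grM r : gr r (r + r) = q ^+ r.
Proof. by rewrite /gr /grid exprD -mulrA divff ?mulr1// expf_neq0// gt_eqF. Qed.

Let window r : set O :=
  [set w | forall i, q ^- r < U i w <= q ^+ r -> U i w * W i w <= x].

Let U_gt0 i w : 0 < U i w. Proof. by case: UP => _ []. Qed.

Let mU i : measurable_fun setT (U i). Proof. by case: UP. Qed.

Let window_measurable r : measurable (window r).
Proof.
rewrite (_ : window r = \bigcap_i (~` ([set w | U i w <= q ^+ r] `\`
   [set w | U i w <= q ^- r]) `|` [set w | U i w * W i w <= x])).
  apply: bigcapT_measurable => i; apply: measurableU.
    by apply/measurableC/measurableD; exact: measurable_le.
  by apply: (@measurable_le _ _ _ (fun w => U i w * W i w)); exact: measurable_funM.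
apply/seteqP; split=> w h i.
  move=> _; have [hi|hi] := boolP (q ^- r < U i w <= q ^+ r); first by right; exact: h.
  left=> /= -[h1 /negP]; rewrite -ltNge => h2; by rewrite h1 h2 in hi.
move=> /andP[h1 h2]; have [|//] := h i I.
by case; split=> //=; apply/negP; rewrite -ltNge.
Qed.

(** A test of the mark that ignores the position inside the cell. With [shift = S] it uses the upper
    end and implies [U i w * W i w <= x] for points of the cell; with [shift = id] it uses the lower
    end and is implied by that inequality. *)
Let bound_event (shift : nat -> nat) r i (l : 'I_(r + r)) : set O :=
  [set w | W i w <= x / gr r (shift l)].

(** A test fails with the probability that [1 < gr r (shift l) * v]. The exponent of [pr_all_marked]
    is therefore the expectation of a grid sum, ready for the pointwise bounds [upper_grid_sum] and
    [lower_grid_sum]. *)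
Let pr_bound shift r : pr P (all_marked U (gr r) (@bound_event shift r)) =
  expR (- \int[P]_w \sum_(l < r + r) intensity (gr r) l *
     (1 < gr r (shift l) * v w)%R%:R).
Proof.
rewrite (@pr_all_marked _ _ _ _ _ UP C Cm CT UC_indep _ _ _ _ _
  (fun l : 'I_(r + r) => pr P [set w | W0 w <= x / gr r (shift l)])); last first.
- by move=> i l; rewrite WW0// divr_gt0.
- by move=> i l; apply: CW; rewrite divr_gt0.
- by move=> l; exact: grid_lt.
- by move=> l; exact: gr_gt0.
congr (expR (- _)).
have iE l w : (1 < gr r (shift l) * v w)%R%:R =
    \1_(~` [set w | W0 w <= x / gr r (shift l)]) w :> R.
  rewrite indicE; congr (nat_of_bool _)%:R; apply/idP/idP.
    rewrite inE /= => h; apply/negP; rewrite -ltNge ltr_pdivrMr//.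
    by move: h; rewrite /v mulrA ltr_pdivlMr// mul1r mulrC.
  rewrite inE /= => /negP; rewrite -ltNge ltr_pdivrMr//.
  by rewrite /v mulrA ltr_pdivlMr// mul1r mulrC.
have ii l : P.-integrable setT (EFin \o (fun w =>
     (1 < gr r (shift l) * v w)%R%:R : R)).
  under [X in _ \o X]eq_fun do rewrite iE.
  by apply: integrable_indic => //; apply/measurableC; exact: measurable_le.
rewrite Rintegral_sum; last first.
  move=> l; apply: eq_integrable (integrableZl measurableT
    (intensity (gr r) l) (ii l)) => // w _.
apply: eq_bigr => l _; rewrite RintegralZl//; congr (_ * _).
rewrite -prC; last exact: measurable_le.
rewrite pr_Rintegral; last by apply/measurableC; exact: measurable_le.
by apply: eq_Rintegral => w _; rewrite iE.
Qed.

Let mbound shift r : measurable (all_marked U (gr r) (@bound_event shift r)).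
Proof.
apply: (all_marked_measurable UP Cm) => [l|i l].
- exact: grid_lt.
- by apply: CW; rewrite divr_gt0.
Qed.

Let sum_measurable (shift : nat -> nat) r : measurable_fun setT (fun w =>
  (\sum_(l < r + r) intensity (gr r) l * (1 < gr r (shift l) * v w)%R%:R)%R).
Proof.
apply: measurable_sum => l; apply: measurable_funM => //.
apply: (@measurableT_comp _ _ _ _ _ _ (fun b : bool => b%:R : R)) => //.
by apply: measurable_fun_ltr => //; exact: measurable_funM.
Qed.

Let sum_integrable (shift : nat -> nat) r : P.-integrable setT (EFin \o (fun w =>
  (\sum_(l < r + r) intensity (gr r) l * (1 < gr r (shift l) * v w)%R%:R)%R)).
Proof.
apply: (@eq_integrable _ _ _ P setT measurableT (EFin \o (fun w =>
  (\sum_(l < r + r) intensity (gr r) l * (1 < gr r (shift l) * v w)%R%:R) * 1)%R)).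
  by move=> w _; rewrite /= mulr1.
apply: (@integrable_bounded_mul _ _ _ P _ (fun=> 1)
  (\sum_(l < r + r) intensity (gr r) l)) => //.
- move=> w; have i0 l : 0 <= intensity (gr r) l.
    by apply: intensity_ge0 => [k|k]; [exact: gr_gt0|exact: grid_lt].
  rewrite ger0_norm; last by apply: sumr_ge0 => l _; rewrite mulr_ge0.
  by apply: ler_sum => l _; rewrite ler_piMr// lern1; case: (1 < _)%R.
- exact: finite_measure_integrable_cst.
Qed.

Let pr_window_ge r : expR (- (q * e)) <= pr P (window r).
Proof.
apply: (@le_trans _ _ (pr P (all_marked U (gr r) (@bound_event S r)))); last first.
  apply: le_pr => // w h i hi.
  have [l hl] : exists l : 'I_(r + r), gr r l < U i w <= gr r l.+1.
    by apply: grid_cell; rewrite -/(gr r _) -/(gr r _) gr0 grM.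
  have := h i l hl; rewrite /bound_event /= ler_pdivlMr// => hW.
  by rewrite mulrC (le_trans _ hW)// ler_wpM2l//; case/andP: hl.
rewrite pr_bound ler_expR lerN2 -ev -RintegralZl//.
apply: le_Rintegral => //.
- by apply: eq_integrable (integrableZl measurableT q iv) => // w _.
- move=> w _; apply: le_trans (upper_grid_sum (v w) q1 (beta0 r) (r + r)) _.
  by rewrite ge_max mulr_ge0 ?(ltW q0)// gerBl invr_ge0 ltW//; exact: gr_gt0.
Qed.

(** The minimum of [lower_grid_sum] for [beta = q ^- r]: the cap [q ^+ r] is the whole mass of
    [u^-2 du] above the lowest grid point. *)
Let capped r w := Num.min (v w / q) (q ^+ r).

Let capped_ge0 r w : 0 <= capped r w.
Proof. by rewrite le_min divr_ge0 ?(ltW q0)// exprn_ge0// ltW. Qed.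

Let capped_measurable r : measurable_fun setT (capped r).
Proof. by apply: measurable_minr => //; exact: measurable_funM. Qed.

Let ivq : P.-integrable setT (EFin \o (fun w => v w / q)).
Proof. by apply: eq_integrable (integrableZr measurableT q^-1 iv) => // w _. Qed.

Let capped_integrable r : P.-integrable setT (EFin \o capped r).
Proof.
apply: le_integrable ivq => //; first exact/measurable_EFinP.
move=> w _ /=; rewrite lee_fin (ger0_norm (capped_ge0 r w)) ger0_norm.
  by rewrite ge_min lexx.
by rewrite divr_ge0 ?(ltW q0).
Qed.

Let pr_window_le r :
  pr P (window r) <= expR (- (\int[P]_w capped r w - q ^- r)).
Proof.
apply: (@le_trans _ _ (pr P (all_marked U (gr r) (@bound_event id r)))).
  apply: le_pr => // w h i l /andP[h1 h2]; rewrite /bound_event /= ler_pdivlMr//.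
  have hM : (l < r + r)%N by [].
  apply: le_trans (h i _); first by rewrite mulrC ler_wpM2r// ltW.
  rewrite -gr0 -grM (le_lt_trans _ h1) ?(le_trans h2)//.
    by rewrite (grid_homo q1 (beta0 r)).
  by rewrite (grid_homo q1 (beta0 r)).
rewrite pr_bound ler_expR lerN2.
have -> : q ^- r = \int[P]_w (q ^- r) 
  by rewrite Rintegral_cst// [fine _](prT P) mulr1.
have ic : P.-integrable setT (EFin \o (fun _ : O => q ^- r)).
  exact: finite_measure_integrable_cst.
rewrite -RintegralB//; apply: le_Rintegral => //.
  by apply: eq_integrable (integrableB measurableT (capped_integrable r) ic) => // w _.
  exact: (sum_integrable id r).
move=> w _; apply: le_trans (lower_grid_sum (v w) q1 (beta0 r) (r + r)).
by rewrite -/(gr r _) grM invrK.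
Qed.

Let qV_cvg : (fun r => q ^- r) @ \oo --> 0.
Proof.
under eq_fun do rewrite -exprVn.
by apply: cvg_expr; rewrite ger0_norm ?invr_ge0 ?(ltW q0)// invf_lt1.
Qed.

Let qV_lt y : 0 < y -> exists N, forall n, (N <= n)%N -> q ^- n < y.
Proof.
move=> y0; have /cvgr_lt/(_ _ y0)[N _ NP] := qV_cvg.
by exists N => n Nn; apply: NP.
Qed.

Let capped_cvg : (fun r => \int[P]_w capped r w) @ \oo --> e / q.
Proof.
have -> : e / q = \int[P]_w (v w / q) by rewrite RintegralZr// ev.
apply: (Rintegral_dominated_cvg _ _ ivq) => // [w|n w]; last first.
  by rewrite ger0_norm// ge_min lexx.
apply: cvg_near_cst.
have y1 : 0 < v w / q + 1 by rewrite ltr_wpDl// divr_ge0// ltW.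
have yV : 0 < (v w / q + 1)^-1 by rewrite invr_gt0.
have [N NP] := qV_lt yV; exists N => // n /= Nn; apply: min_l.
have qn : 0 < q ^+ n by rewrite exprn_gt0.
have := NP n Nn; rewrite ltf_pV2 ?posrE// => h.
by apply: le_trans (ltW h); rewrite lerDl.
Qed.

(** Every [U i w] is positive and finite, hence lies in all large windows, and the constraints
    accumulate as the windows widen. *)
Let window_cvg : (fun r => pr P (window r)) @ \oo -->
  pr P [set w | forall i, U i w * W i w <= x].
Proof.
have -> : [set w | forall i, U i w * W i w <= x] = \bigcap_r window r.
  apply/seteqP; split=> w h; first by move=> r _ i _; exact: h.
  move=> i; have [N1 h1] := qV_lt (U_gt0 i w).
  have UV : 0 < (U i w)^-1 by rewrite invr_gt0.
  have [N2 h2] := qV_lt UV.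
  apply: (h (maxn N1 N2) I); rewrite h1 ?leq_maxl//=.
  have := h2 (maxn N1 N2); rewrite leq_maxr => /(_ isT).
  by rewrite ltf_pV2 ?posrE ?exprn_gt0// => /ltW.
apply: nonincreasing_cvg_pr => // m n mn w h i /andP[h1 h2]; apply: h.
have qmn : q ^+ m <= q ^+ n by rewrite ler_eXn2l.
rewrite (le_trans h2)// andbT (le_lt_trans _ h1)//.
by rewrite lef_pV2 ?posrE ?exprn_gt0.
Qed.

Lemma pr_poisson_max_ratio :
  expR (- (q * e)) <= pr P [set w | forall i, U i w * W i w <= x] <= expR (- (e / q)).
Proof.
apply/andP; split.
  apply: (ler_cvg_to (cvg_cst _) window_cvg); apply: nearW => r.
  exact: pr_window_ge.
apply: (@ler_cvg_to _ _ _ _ _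
  (fun r => expR (- (\int[P]_w capped r w - q ^- r))) _ _ window_cvg).
  apply: continuous_cvg; first exact: continuous_expR.
  by apply: cvgN; rewrite -[X in _ --> X]subr0; apply: cvgB.
by apply: nearW => r; exact: pr_window_le.
Qed.

End ratio.

Lemma pr_poisson_max :
  pr P [set w | forall i, U i w * W i w <= x] =
  expR (- ((\int[P]_w W0 w) / x)).
Proof.
rewrite -/e; set p := pr _ _.
pose q (n : nat) : R := 1 + n.+1%:R^-1.
have q1 n : 1 < q n by rewrite ltrDl.
have q_cvg : q @ \oo --> (1 : R).
  rewrite -[X in _ --> X]addr0; apply: cvgD; first exact: cvg_cst.
  exact: cvg_harmonic.
have b n := pr_poisson_max_ratio (q1 n).
have c1 : (fun n => expR (- (e / q n))) @ \oo --> expR (- e).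
  apply: continuous_cvg; first exact: continuous_expR.
  apply: cvgN; rewrite -[X in _ --> X]divr1; apply: cvgMr.
  by apply: cvgV => //; exact: oner_neq0.
have c2 : (fun n => expR (- (q n * e))) @ \oo --> expR (- e).
  apply: continuous_cvg; first exact: continuous_expR.
  by apply: cvgN; rewrite -[X in _ --> X]mul1r; apply: cvgMl.
apply/eqP; rewrite eq_le; apply/andP; split.
  apply: (ler_cvg_to (cvg_cst p) c1).
  by apply: nearW => n; case/andP: (b n).
apply: (ler_cvg_to c2 (cvg_cst p)).
by apply: nearW => n; case/andP: (b n).
Qed.

End poisson_maximum.

(** * From convergence of maxima to tails *)

Lemma measurable_bigmax (R : realType) (d : measure_display) (O : measurableType d)
    (I : finType) (f : I -> O -> R) : (forall i, measurable_fun setT (f i)) ->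
  measurable_fun setT (fun w => \big[Num.max/0]_i f i w).
Proof.
move=> mf; elim: (index_enum I) => [|i s IH].
  under eq_fun do rewrite big_nil.
  exact: measurable_cst.
under eq_fun do rewrite big_cons.
exact: measurable_maxr.
Qed.

Lemma continuous_bigmax (R : realType) (T : topologicalType) (I : finType)
    (f : I -> T -> R) : (forall i, continuous (f i)) ->
  continuous (fun v => \big[Num.max/0]_i f i v : R).
Proof.
move=> cf; elim: (index_enum I) => [|i s IH] v.
  under eq_fun do rewrite big_nil.
  exact: cvg_cst.
under eq_fun do rewrite big_cons.
by apply: (continuous_max (f := f i) (g := fun v => \big[Num.max/0]_(j <- s) f j v));
  [exact: cf|exact: IH].
Qed.

Section ramp.
Variables (R : realType) (a e : R).
Hypothesis e0 : 0 < e.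

Definition ramp (u : R) : R := Num.min 1 (Num.max 0 ((a + e - u) / e)).

Lemma ramp_continuous : continuous ramp.
Proof.
move=> u; apply: (continuous_min (f := fun=> 1)
  (g := fun u => Num.max 0 ((a + e - u) / e))); first exact: cvg_cst.
apply: (continuous_max (f := fun=> 0) (g := fun u => (a + e - u) / e)).
  exact: cvg_cst.
by apply: cvgMl; apply: cvgB; [exact: cvg_cst|exact: cvg_id].
Qed.

Lemma ramp_ge0 u : 0 <= ramp u.
Proof. by rewrite /ramp le_min ler01 le_max lexx. Qed.

Lemma ramp_le1 u : ramp u <= 1.
Proof. by rewrite /ramp ge_min lexx. Qed.

Lemma ramp_ge u : (u <= a)%R%:R <= ramp u.
Proof.
case: (leP u a) => [ua|_]; last exact: ramp_ge0.
rewrite /ramp le_min lexx le_max; apply/orP; right.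
by rewrite ler_pdivlMr// mul1r; lra.
Qed.

Lemma ramp_le u : ramp u <= (u <= a + e)%R%:R.
Proof.
case: (leP u (a + e)) => [_|au]; first exact: ramp_le1.
rewrite /ramp ge_min; apply/orP; right; rewrite ge_max lexx /=.
by rewrite pmulr_lle0 ?invr_gt0//; lra.
Qed.

Variables (d : measure_display) (O : measurableType d) (P : probability O R).
Variable X : O -> R.
Hypothesis mX : measurable_fun setT X.

Let ir : P.-integrable setT (EFin \o (ramp \o X)).
Proof.
apply: (@eq_integrable _ _ _ P setT measurableT (EFin \o (fun w => ramp (X w) * 1))).
  by move=> w _; rewrite /= mulr1.
apply: (@integrable_bounded_mul _ _ _ P (ramp \o X) (fun=> 1) 1).
- apply: measurableT_comp => //; apply: continuous_measurable_fun.
  exact: ramp_continuous.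
- by move=> w /=; rewrite ger0_norm ?ramp_ge0// ramp_le1.
- exact: finite_measure_integrable_cst.
Qed.

Let i1 b : P.-integrable setT (EFin \o (fun w => (X w <= b)%R%:R : R)).
Proof.
rewrite (_ : (fun w => _) = \1_[set w | X w <= b]).
  by apply: integrable_indic => //; exact: measurable_le.
by apply/funext => w; rewrite indicE; congr (nat_of_bool _)%:R; apply/idP/idP; rewrite inE.
Qed.

Let pr1 b : pr P [set w | X w <= b] = \int[P]_w ((X w <= b)%R%:R : R).
Proof.
rewrite pr_Rintegral; last exact: measurable_le.
apply: eq_Rintegral => w _; rewrite indicE; congr (nat_of_bool _)%:R.
by apply/idP/idP; rewrite inE.
Qed.

Lemma pr_le_ramp : pr P [set w | X w <= a] <= \int[P]_w ramp (X w).
Proof.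
by rewrite pr1; apply: le_Rintegral => // w _; exact: ramp_ge.
Qed.

Lemma ramp_le_pr : \int[P]_w ramp (X w) <= pr P [set w | X w <= a + e].
Proof.
by rewrite pr1; apply: le_Rintegral => // w _; exact: ramp_le.
Qed.

End ramp.

(** The ramp that starts to fall at [x] bounds the distribution functions at [x] from above, the one
    that reaches 0 at [x] bounds them from below. Continuity of the limit at [x] brings both within
    [e] of the value there. *)
Lemma cdf_cvg (R : realType) (d1 d2 : measure_display)
    (O1 : measurableType d1) (O2 : measurableType d2)
    (P1 : probability O1 R) (P2 : probability O2 R)
    (X : nat -> O1 -> R) (Y : O2 -> R) (x : R) :
  (forall n, measurable_fun setT (X n)) -> measurable_fun setT Y ->
  (forall a e : R, 0 < e -> (fun n => \int[P1]_w ramp a e (X n w)) @ \oo -->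
    \int[P2]_w ramp a e (Y w)) ->
  {for x, continuous (fun y => pr P2 [set w | Y w <= y])} ->
  (fun n => pr P1 [set w | X n w <= x]) @ \oo --> pr P2 [set w | Y w <= x].
Proof.
move=> mX mY cXY cG; apply/cvgrPdist_lt => e e0.
have /cvgrPdist_lt/(_ _ e0)/nbhs_ballP[r /= r0 rP] := cG.
pose s := r / 2.
have s0 : 0 < s by rewrite divr_gt0.
have sr : s < r by rewrite ltr_pdivrMr// ltr_pMr// ltr1n.
have hi : `|pr P2 [set w | Y w <= x] - pr P2 [set w | Y w <= x + s]| < e.
  by apply: rP; rewrite /ball /= opprD addrA subrr sub0r normrN gtr0_norm.
have lo : `|pr P2 [set w | Y w <= x] - pr P2 [set w | Y w <= x - s]| < e.
  by apply: rP; rewrite /ball /= opprB addrCA subrr addr0 gtr0_norm.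
have c1 := cXY x s s0.
have c2 := cXY (x - s) s s0.
have b1 : \int[P2]_w ramp x s (Y w) < pr P2 [set w | Y w <= x] + e.
  apply: le_lt_trans (ramp_le_pr x s0 P2 mY) _.
  by move: hi; rewrite ltr_norml => /andP[]; lra.
have b2 : pr P2 [set w | Y w <= x] - e < \int[P2]_w ramp (x - s) s (Y w).
  apply: lt_le_trans (pr_le_ramp (x - s) s0 P2 mY).
  by move: lo; rewrite ltr_norml => /andP[]; lra.
move/cvgr_lt/(_ _ b1) : c1 => c1; move/cvgr_gt/(_ _ b2) : c2 => c2.
near=> n.
have h1 : \int[P1]_w ramp x s (X n w) < pr P2 [set w | Y w <= x] + e by near: n.
have h2 : pr P2 [set w | Y w <= x] - e < \int[P1]_w ramp (x - s) s (X n w) by near: n.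
have := pr_le_ramp x s0 P1 (mX n); have := ramp_le_pr (x - s) s0 P1 (mX n).
rewrite subrK ltr_norml => h3 h4.
by apply/andP; split; lra.
Unshelve. all: by end_near. Qed.

(** With [t = - ln (p n)], the number [1 - expR (- t)] lies between [t / (1 + t)] and [t], while
    [(n + 1) t] tends to [K]. *)
Lemma power_cvg_tail (R : realType) (p : nat -> R) (K : R) :
  (forall n, 0 <= p n <= 1) ->
  (fun n => p n ^+ n.+1) @ \oo --> expR (- K) ->
  (fun n => n.+1%:R * (1 - p n)) @ \oo --> K.
Proof.
move=> p01 cp; pose L n := - ln (p n ^+ n.+1).
have cL : L @ \oo --> K.
  rewrite -[X in _ --> X]opprK; apply: cvgN; rewrite -[X in _ --> X](expRK (- K)).
  by apply: continuous_cvg; [exact/continuous_ln/expR_gt0|exact: cp].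
have cLn : (fun n => L n / (1 + L n / n.+1%:R)) @ \oo --> K.
  rewrite -[X in _ --> X]divr1; apply: cvgM => //; apply: cvgV; first exact: oner_neq0.
  rewrite -[X in _ --> X]addr0; apply: cvgD; first exact: cvg_cst.
  by rewrite -[X in _ --> X](mulr0 K); apply: cvgM => //; exact: cvg_harmonic.
apply: squeeze_cvgr cLn cL.
(* The limit is positive, so [p n] is eventually positive and its logarithm is not a default
   value. *)
have /cvgr_gt/(_ _ (expR_gt0 (- K))) := cp.
apply: filterS => n pn.
have pn0 : 0 < p n.
  have /andP[] := p01 n; rewrite le_eqVlt => /predU1P[p0|//].
  by rewrite -p0 expr0n ltxx in pn.
have n0 : (0 : R) < n.+1%:R by [].
pose t := - ln (p n).
have LE : L n = n.+1%:R * t by rewrite /L /t lnXn// mulr_natl mulNrn.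
have pE : p n = expR (- t) by rewrite opprK lnK.
have t0 : 0 <= t by rewrite oppr_ge0 ln_le0//; case/andP: (p01 n).
have tL : L n / n.+1%:R = t by rewrite LE mulrAC divff ?mul1r// gt_eqF.
rewrite tL pE LE -mulrA !ler_pM2l//; apply/andP; split; last first.
  by have := expR_ge1Dx (- t); lra.
have t1 : 0 < 1 + t by rewrite ltr_pwDl.
rewrite ler_pdivrMr// expRN mulrBl mul1r.
have : (expR t)^-1 * (1 + t) <= 1.
  by rewrite mulrC ler_pdivrMr ?expR_gt0// mul1r expR_ge1Dx.
lra.
Qed.

(** For [N <= a < N + 1] and [u] the tail function, [N u(N + 1) <= a u(a) <= (N + 1) u(N)] by
    monotonicity. The mismatch by one costs a single value of [u], which tends to 0 because
    [(n + 1) u(n + 1)] converges. *)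
Lemma real_tail_cvg (R : realType) (d : measure_display) (O : measurableType d)
    (P : probability O R) (Y : O -> R) (K : R) (a : nat -> R) :
  measurable_fun setT Y ->
  (fun n => n.+1%:R * (1 - pr P [set w | Y w <= n.+1%:R])) @ \oo --> K ->
  a @ \oo --> +oo ->
  (fun n => a n * pr P [set w | a n < Y w]) @ \oo --> K.
Proof.
move=> mY cK ha; pose u (s : R) := 1 - pr P [set w | Y w <= s].
have uE s : pr P [set w | s < Y w] = u s.
  rewrite /u -prC; last exact: measurable_le.
  congr (pr P _); apply/seteqP; split=> w /=; first by rewrite ltNge => /negP.
  by move/negP; rewrite -ltNge.
have u_ge0 s : 0 <= u s by rewrite -uE pr_ge0.
have u_le s s' : s <= s' -> u s' <= u s.
  move=> ss'; rewrite lerD2l lerN2; apply: le_pr; [exact: measurable_le..|].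
  by move=> w /= /le_trans; apply.
have cu : (fun n => u n.+1%:R) @ \oo --> (0 : R).
  rewrite (_ : (fun n => u n.+1%:R) = (fun n => n.+1%:R^-1 * (n.+1%:R * u n.+1%:R))).
    rewrite -(mul0r K); apply: cvgM => //; exact: cvg_harmonic.
  by apply/funext => n; rewrite mulrA mulVf ?mul1r.
have cN : (fun n => Num.truncn (a n)) @ \oo --> \oo.
  apply/cvgnyPge => A; have /cvgryPge/(_ A%:R) := ha.
  apply: filterS => n An; rewrite truncn_ge_nat//.
  exact: le_trans An.
pose lo n := n.+1%:R * u n.+1%:R - u n.+1%:R.
pose hi n := n%:R * u n%:R + u n%:R.
have clo : lo @ \oo --> K by rewrite -[X in _ --> X]subr0; exact: cvgB.
have chi : hi @ \oo --> K.
  rewrite -cvg_shiftS -[K]addr0.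
  by apply: cvgD.
have cl := cvg_comp _ _ cN clo; have ch := cvg_comp _ _ cN chi.
apply: squeeze_cvgr cl ch.
have /cvgryPge/(_ 0) := ha; apply: filterS => n a0.
rewrite uE /lo /hi /=; set N := Num.truncn (a n).
have /andP[Na aN] : N%:R <= a n < N.+1%:R by apply: truncn_itv.
have -> : N.+1%:R * u N.+1%:R - u N.+1%:R = N%:R * u N.+1%:R.
  by rewrite -natr1; ring.
have -> : N%:R * u N%:R + u N%:R = N.+1%:R * u N%:R by rewrite -natr1; ring.
by apply/andP; split; apply: ler_pM => //; [exact/u_le/ltW|exact: ltW|exact: u_le].
Qed.

(** * The maxima of the spectral representation *)

Section weighted_max.
Variables (R : realType) (m : nat) (c : 'I_m -> R).
Hypothesis c0 : forall j, 0 < c j.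

(** The maximum starts from 0 and is nonnegative for every [v]; hence the condition [0 <= y] on
    thresholds below. *)
Definition wmax (v : 'I_m -> R) : R := \big[Num.max/0]_j (c j * v j).

Lemma wmax_leP v y : 0 <= y -> reflect (forall j, c j * v j <= y) (wmax v <= y).
Proof.
move=> y0; apply: (iffP (bigmax_leP _ _ _ _)) => [[_ h] j|h]; first exact: h.
by split=> // j _; exact: h.
Qed.

Lemma wmax_ge0 v : 0 <= wmax v.
Proof. by have /bigmax_leP[] := lexx (wmax v). Qed.

Variable T : Type.
Variable s : 'I_m -> T.

Definition wmax_cyl (y : R) : seq (T * R) := [seq (s j, y / c j) | j <- enum 'I_m].

(** Displays the event as a cylinder, the form in which equality of finite-dimensional laws and
    independence are given. *)
Lemma wmax_cylE (O : Type) (X : T -> O -> R) y : 0 <= y ->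
  [set w | wmax (fun j => X (s j) w) <= y] =
  [set w | all (fun tx => X tx.1 w <= tx.2) (wmax_cyl y)].
Proof.
move=> y0; apply/seteqP; split=> w /=.
  move/(wmax_leP _ y0) => h; rewrite all_map; apply/allP => j _ /=.
  by rewrite ler_pdivlMr// mulrC.
rewrite all_map => /allP h; apply/(wmax_leP _ y0) => j.
by have := h j; rewrite mem_enum /= ler_pdivlMr// mulrC; apply.
Qed.

Lemma wmax_measurable (d : measure_display) (O : measurableType d) (X : T -> O -> R) :
  (forall t, measurable_fun setT (X t)) ->
  measurable_fun setT (fun w => wmax (fun j => X (s j) w)).
Proof.
by move=> mX; apply: measurable_bigmax => j; exact: measurable_funM.
Qed.

End weighted_max.

Section spectral_representation.
Variables (R : realType) (T : Type) (d : measure_display) (O : measurableType d).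
Variable P : probability O R.
Variables (V : T -> O -> R) (U : nat -> O -> R) (Vs : nat -> T -> O -> R).
Variable xi : T -> O -> R.
Hypothesis mV : forall t, measurable_fun [set: O] (V t).
Hypothesis V0 : forall t w, 0 <= V t w.
Hypothesis EV : forall t, (\int[P]_w (V t w)%:E = 1)%E.
Hypothesis UP : PPP_u2 P U.
Hypothesis mVs : forall i t, measurable_fun [set: O] (Vs i t).
Hypothesis VsV : forall i, same_fdd P P (Vs i) V.
Hypothesis indep : mutually_indep P
  (fun o : option nat => match o with None => cyl U | Some i => cyl (Vs i) end).
Hypothesis xiE : forall t w, xi t w = sup (range (fun i => U i w * Vs i t w)).

Lemma V_integrable t : P.-integrable setT (EFin \o V t).
Proof.
apply/integrableP; split; first exact/measurable_EFinP.
under eq_integral do rewrite /= ger0_norm//.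
by rewrite EV ltry.
Qed.

(** [sup] is 0 on an unbounded set, so the space is split: on [B], where the products are bounded,
    [xi] is a countable supremum of measurable functions, and off [B] it is constant. *)
Lemma xi_measurable t : measurable_fun setT (xi t).
Proof.
pose Z i w := U i w * Vs i t w.
have mU i : measurable_fun setT (U i) by case: UP.
have mZ i : measurable_fun setT (Z i) by exact: measurable_funM.
pose B := \bigcup_(N : nat) \bigcap_i [set w | Z i w <= N%:R].
have mB : measurable B.
  apply: bigcup_measurable => N _; apply: bigcapT_measurable => i.
  exact: measurable_le.
have BP w : B w <-> has_ubound (range (fun i => Z i w)).
  split=> [[N _ h]|[x h]].
    by exists N%:R => _ [i _ <-]; exact: h.
  exists (Num.truncn x).+1 => // i _ /=.
  by apply: le_trans (ltW (truncnS_gt x)); apply: h; exists i.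
rewrite -(setvU B); apply/measurable_funU => //; first exact: measurableC.
split.
  apply: (@eq_measurable_fun _ _ _ _ _ (fun=> 0 : R)) => [w|]; last exact: measurable_cst.
  rewrite inE => nB; rewrite xiE sup_out// => -[_ ub]; apply: nB; exact/BP.
apply: (@eq_measurable_fun _ _ _ _ _ (fun w => sups (fun i => Z i w) 0%N)).
  move=> w _; rewrite xiE /sups /=; congr sup; apply/seteqP; split=> x /= [i _ <-];
  by exists i.
apply: measurable_fun_sups => [w /BP//|i].
exact: measurable_funTS.
Qed.

Variables (m : nat) (s : 'I_m -> T) (c : 'I_m -> R).
Hypothesis c0 : forall j, 0 < c j.

Let W i w := wmax c (fun j => Vs i (s j) w).
Let W0 w := wmax c (fun j => V (s j) w).

Lemma wmax_V_integrable : P.-integrable setT (EFin \o W0).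
Proof.
apply: (@le_integrable _ _ _ P setT measurableT _
    (EFin \o (fun w => \sum_j c j * V (s j) w))).
- exact/measurable_EFinP/wmax_measurable.
- move=> w _ /=; rewrite lee_fin ger0_norm ?wmax_ge0//.
  have c0' j : 0 <= c j * V (s j) w by rewrite mulr_ge0// ltW.
  apply: le_trans (ler_norm _); apply/wmax_leP; first exact: sumr_ge0.
  by move=> j; rewrite (bigD1 j)//= lerDl sumr_ge0.
- apply: eq_integrable (integrable_sum measurableT (index_enum 'I_m)
    (fun j _ => integrableZl measurableT (c j) (V_integrable (s j)))) => //.
  by move=> w _; rewrite /= sumEFin.
Qed.

Let K := \int[P]_w W0 w.

Let below (x : R) : set O := [set w | forall i, U i w * W i w <= x].

Let pr_below x : 0 < x -> pr P (below x) = expR (- (K / x)).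
Proof.
move=> x0; apply: (@pr_poisson_max _ _ _ P U UP (fun i => cyl (Vs i))) => //.
- by move=> i; apply: cyl_measurable.
- by move=> i; exact: cylT.
- by move=> i; apply: wmax_measurable.
- by move=> i w; exact: wmax_ge0.
- move=> i y y0; rewrite wmax_cylE// ?ltW//.
  by exists (wmax_cyl c s y).
- by move=> w; exact: wmax_ge0.
- exact: wmax_V_integrable.
- move=> i y y0; rewrite /pr !wmax_cylE// ?ltW//.
  by rewrite VsV.
Qed.

Let U_gt0 i w : 0 < U i w. Proof. by case: UP => _ []. Qed.

Let below_measurable x : measurable (below x).
Proof.
rewrite (_ : below x = \bigcap_i [set w | U i w * W i w <= x]).
  apply: bigcapT_measurable => i.
  apply: (@measurable_le _ _ _ (fun w => U i w * W i w)).
  by apply: measurable_funM; [case: UP|exact: wmax_measurable].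
by apply/seteqP; split=> w h i; [move=> _; exact: h|exact: h].
Qed.

Let belowP x w : 0 <= x ->
  below x w <-> (forall j i, U i w * Vs i (s j) w <= x / c j).
Proof.
move=> x0; split=> [h j i|h i].
  rewrite ler_pdivlMr//; apply: le_trans (h i).
  by rewrite -mulrA ler_pM2l// mulrC le_bigmax.
rewrite mulrC -ler_pdivlMr//; apply/wmax_leP; first by rewrite divr_ge0// ltW.
by move=> j; have := h j i; rewrite !ler_pdivlMr//;
  congr (_ <= _); ring.
Qed.

(** [below x] implies the event, but the default value of an unbounded [sup] could add outcomes to
    it. These lie outside [N], on which the products are bounded, and [N] has probability 1 because
    [expR (- (K / (n + 1)))] tends to 1. *)
Lemma cdf_wmax_xi x : 0 < x ->
  pr P [set w | wmax c (fun j => xi (s j) w) <= x] = expR (- (K / x)).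
Proof.
move=> x0; rewrite -pr_below//.
have mM : measurable [set w | wmax c (fun j => xi (s j) w) <= x].
  by apply: measurable_le; apply: wmax_measurable; exact: xi_measurable.
pose N := \bigcup_n below n.+1%:R.
have mN : measurable N by exact: bigcup_measurable.
have prN : pr P N = 1.
  have cN : (fun n => pr P (below n.+1%:R)) @ \oo --> pr P N.
    apply: nondecreasing_cvg_pr => // n n' nn' w h i; apply: le_trans (h i) _.
    by rewrite ler_nat ltnS.
  have c1 : (fun n => pr P (below n.+1%:R)) @ \oo --> (1 : R).
    rewrite (_ : (fun n => _) = (fun n => expR (- (K / n.+1%:R)))); last first.
      by apply/funext => n; rewrite pr_below.
    rewrite -[X in _ --> X]expR0; apply: continuous_cvg; first exact: continuous_expR.
    rewrite -oppr0; apply: cvgN; rewrite -[X in _ --> X](mulr0 K).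
    by apply: cvgMr; exact: cvg_harmonic.
  exact: cvg_unique cN c1.
have sub1 : below x `<=` [set w | wmax c (fun j => xi (s j) w) <= x].
  move=> w /(belowP _ (ltW x0)) h; apply/wmax_leP; first exact: ltW.
  move=> j; rewrite mulrC -ler_pdivlMr// xiE; apply: ge_sup.
    by exists (U 0%N w * Vs 0%N (s j) w), 0%N.
  by move=> _ [i _ <-]; exact: h.
have sub2 : [set w | wmax c (fun j => xi (s j) w) <= x] `&` N `<=` below x.
  move=> w [/(wmax_leP _ _ (ltW x0)) h [n _ /(belowP w (ler0n _ _)) hn]].
  apply/belowP; first exact: ltW.
  move=> j i; apply: (@le_trans _ _ (xi (s j) w)); last first.
    by rewrite ler_pdivlMr// mulrC.
  rewrite xiE; apply: ub_le_sup; last by exists i.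
  by exists (n.+1%:R / c j) => _ [k _ <-]; exact: hn.
apply/eqP; rewrite eq_le; apply/andP; split; last exact: le_pr.
have /le_pr : [set w | wmax c (fun j => xi (s j) w) <= x] `<=` below x `|` ~` N.
  by move=> w h; have [Nw|nN] := pselect (N w); [left; exact: sub2|right].
move=> /(_ _ P mM (measurableU _ _ (below_measurable x) (measurableC mN))) h.
apply: le_trans h _; apply: (le_trans (le_prU _ _ _)) => //.
  exact: measurableC.
by rewrite prC// prN subrr addr0.
Qed.

End spectral_representation.

(** * Tails of weighted maxima in the domain of attraction *)

Section domain_of_attraction.
Variables (R : realType) (T : Type).
Variables (d2 : measure_display) (O2 : measurableType d2) (P2 : probability O2 R).
Variables (V : T -> O2 -> R) (U : nat -> O2 -> R) (Vs : nat -> T -> O2 -> R).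
Variable xi : T -> O2 -> R.
Hypothesis mV : forall t, measurable_fun [set: O2] (V t).
Hypothesis V0 : forall t w, 0 <= V t w.
Hypothesis EV : forall t, (\int[P2]_w (V t w)%:E = 1)%E.
Hypothesis UP : PPP_u2 P2 U.
Hypothesis mVs : forall i t, measurable_fun [set: O2] (Vs i t).
Hypothesis VsV : forall i, same_fdd P2 P2 (Vs i) V.
Hypothesis indep : mutually_indep P2
  (fun o : option nat => match o with None => cyl U | Some i => cyl (Vs i) end).
Hypothesis xiE : forall t w, xi t w = sup (range (fun i => U i w * Vs i t w)).
Variables (d1 : measure_display) (O1 : measurableType d1) (P1 : probability O1 R).
Variables (eta : T -> O1 -> R) (etas : nat -> T -> O1 -> R).
Hypothesis meta : forall t, measurable_fun [set: O1] (eta t).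
Hypothesis metas : forall i t, measurable_fun [set: O1] (etas i t).
Hypothesis etas_eta : forall i, same_fdd P1 P1 (etas i) eta.
Hypothesis etas_indep : mutually_indep P1 (fun i : nat => cyl (etas i)).
Hypothesis MDA : forall (m : nat) (s : 'I_m -> T),
  cvg_in_law P1 P2
    (fun n w => \row_(j < m)
       ((n.+1)%:R^-1 * \big[Num.max/0]_(i < n.+1) etas i (s j) w))
    (fun w => \row_(j < m) xi (s j) w).
Variable a : nat -> R.
Hypothesis a_cvg : a @ \oo --> +oo.

Lemma tail_wmax (m : nat) (s : 'I_m -> T) (c : 'I_m -> R) :
  (forall j, 0 < c j) ->
  (fun n => a n * pr P1 [set w | a n < wmax c (fun j => eta (s j) w)]) @ \oo -->
  \int[P2]_w wmax c (fun j => V (s j) w).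
Proof.
move=> c0; set K := Rintegral _ _ _.
apply: real_tail_cvg => //; first exact: wmax_measurable.
apply: power_cvg_tail => [n|].
  by rewrite pr_ge0 pr_le1//; apply: measurable_le; exact: wmax_measurable.
pose M n w := wmax c (fun j =>
  n.+1%:R^-1 * \big[Num.max/0]_(i < n.+1) etas i (s j) w).
have mM n : measurable_fun setT (M n).
  apply: measurable_bigmax => j; apply: measurable_funM => //.
  by apply: measurable_funM => //; apply: measurable_bigmax => i; exact: metas.
(* Exchanging the maxima over sites and over copies: [M n w <= 1] says that each of the [n + 1]
   independent copies has weighted maximum at most [n + 1]. *)
have cdfM n : pr P1 [set w | M n w <= 1] =
    pr P1 [set w | wmax c (fun j => eta (s j) w) <= n.+1%:R] ^+ n.+1.
  have n0 : (0 : R) < n.+1%:R by [].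
  transitivity (pr P1 (\big[setI/setT]_(i <- index_iota 0 n.+1)
     [set w | wmax c (fun j => etas i (s j) w) <= n.+1%:R])).
    congr (pr P1 _); rewrite -bigcap_seq; apply/seteqP; split=> w /=.
      move/(wmax_leP _ _ ler01) => h i; rewrite /= mem_index_iota /= => ni.
      apply/wmax_leP => // j; have := h j; rewrite mulrCA ler_pdivrMl// mulr1.
      apply: le_trans; rewrite ler_pM2l//.
      exact: (le_bigmax _ (fun i : 'I_n.+1 => etas i (s j) w) (Ordinal ni)).
    move=> h; apply/wmax_leP => // j; rewrite mulrCA ler_pdivrMl// mulr1.
    rewrite mulrC -ler_pdivlMr//; apply/bigmax_leP; split.
      by rewrite divr_ge0// ltW.
    move=> i _; rewrite ler_pdivlMr// mulrC.
    have hi : wmax c (fun j => etas i (s j) w) <= n.+1%:R.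
      by apply: h; rewrite /= mem_index_iota /=.
    by move/(wmax_leP _ _ (ltW n0)) : hi; exact.
  have := @etas_indep (index_iota 0 n.+1)
    (fun i => [set w | wmax c (fun j => etas i (s j) w) <= n.+1%:R]).
  rewrite /pr => ->.
  - rewrite big_mkord (eq_bigr (fun=> pr P1
      [set w | wmax c (fun j => eta (s j) w) <= n.+1%:R])).
      by rewrite prodr_const card_ord.
    by move=> i _; rewrite /pr !wmax_cylE// etas_eta.
  - by rewrite /index_iota iota_uniq.
  - by move=> i _; rewrite wmax_cylE//; exists (wmax_cyl c s n.+1%:R).
have E y : 0 < y -> pr P2 [set w | wmax c (fun j => xi (s j) w) <= y] = expR (- (K / y)).
  exact: (@cdf_wmax_xi _ _ _ _ P2 V U Vs xi mV V0 EV UP mVs VsV indep xiE _ s c c0 y).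
rewrite -[K]divr1 -(E 1 ltr01).
under eq_fun do rewrite -cdfM.
apply: cdf_cvg => //.
- by apply: wmax_measurable => t; exact: (xi_measurable UP mVs xiE).
- move=> b e e0.
  (* The ramp of a weighted maximum is bounded and continuous in the vector, hence a test function
     for [MDA]. *)
  pose f (v : 'rV[R]_m) := ramp b e (wmax c (fun j => v ord0 j)).
  have cf : continuous f.
    move=> v; apply: (@continuous_comp _ _ _ (fun v : 'rV[R]_m =>
      wmax c (fun j => v ord0 j)) (ramp b e)); last exact: ramp_continuous.
    apply: continuous_bigmax => j {}v.
    apply: (@continuous_comp _ _ _ (fun v : 'rV[R]_m => v ord0 j) (fun y : R => c j * y)).
      exact: coord_continuous.
    by apply: cvgMr.
  have bf : exists B : R, forall x, `|f x| <= B.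
    by exists 1 => x; rewrite ger0_norm ?ramp_le1// ramp_ge0.
  have fE (X : 'I_m -> R) : ramp b e (wmax c X) = f (\row_j X j).
    by rewrite /f; congr (ramp _ _ (wmax c _)); apply/funext => j; rewrite mxE.
  have := @MDA m s f cf bf.
  rewrite (_ : (fun n => Ex P1 _) = (fun n => \int[P1]_w ramp b e (M n w))).
    rewrite (_ : Ex P2 _ = \int[P2]_w ramp b e (wmax c (fun j => xi (s j) w))) //.
    by apply: eq_Rintegral => w _; rewrite fE.
  by apply/funext => n; apply: eq_Rintegral => w _; rewrite /M fE.
- have c1 : {for (1 : R), continuous (fun y : R => expR (- (K / y)))}.
    apply: continuous_cvg; first exact: continuous_expR.
    by apply: cvgN; apply: cvgMr; apply: cvgV; [exact: oner_neq0|exact: cvg_id].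
  apply/cvgrPdist_lt => e e0; rewrite E//.
  have /cvgrPdist_lt/(_ _ e0) := c1.
  have y_gt0 : \forall y \near (1 : R), 0 < y by exact: lt_nbhsr.
  by apply: filterS2 y_gt0 => y y0; rewrite E.
Qed.

End domain_of_attraction.

(** * The limit law *)

Section pareto_density.
Variable R : realType.
Local Notation mu := (@lebesgue_measure R).

Definition pareto (z : R) : R := (1 <= z)%R%:R * z ^- 2.

Lemma pareto_ge0 z : 0 <= pareto z.
Proof. by rewrite mulr_ge0// invr_ge0 sqr_ge0. Qed.

Lemma measurable_fun_nat_bool (d : measure_display) (O : measurableType d)
    (b : O -> bool) : measurable_fun setT b ->
  measurable_fun setT (fun w => (b w)%:R : R).
Proof.
by move=> mb; apply: (@measurableT_comp _ _ _ _ _ _ (fun b : bool => b%:R : R)).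
Qed.

Lemma measurable_pareto : measurable_fun setT pareto.
Proof.
rewrite (_ : pareto = (fun z => (1 <= z)%R%:R * (Num.max z 1) `^ (- 2%:R))).
  apply: measurable_funM.
    by apply: measurable_fun_nat_bool; apply: measurable_fun_ler.
  by apply: (measurableT_comp (measurable_powR _)); exact: measurable_maxr.
apply/funext => z; rewrite /pareto; case: (leP 1 z) => z1; last by rewrite !mul0r.
by rewrite powR_invn// (le_trans _ z1).
Qed.

Lemma derivable_Ninv (z : R) : z != 0 -> derivable (fun y : R => - y^-1) z 1.
Proof. by move=> z0; apply: derivableN; apply: derivableV. Qed.

Lemma derive1_Ninv (z : R) : z != 0 -> derive1 (fun y : R => - y^-1) z = z ^- 2.
Proof.
move=> z0; rewrite derive1E deriveN; last exact: derivableV.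
rewrite deriveV// derive_id scaleNr opprK /GRing.scale /= mulr1//.
Qed.

Lemma Ninv_cvg (z : R) : z != 0 -> (fun y : R => - y^-1) y @[y --> z] --> - z^-1.
Proof. by move=> z0; apply: cvgN; apply: cvgV. Qed.

Lemma sqrV_continuous (z : R) : z != 0 -> {for z, continuous (fun y : R => y ^- 2)}.
Proof.
move=> z0; apply: cvgV; first by rewrite expf_neq0.
exact: exprn_continuous.
Qed.

Lemma integral_pareto_le (b : R) : 1 <= b ->
  (\int[mu]_z (pareto z * (z <= b)%R%:R)%:E = (1 - b^-1)%:E)%E.
Proof.
move=> b1; transitivity (\int[mu]_(z in `[1%R, b]) (z ^- 2)%:E)%E.
  rewrite [RHS]integral_mkcond; apply: eq_integral => z _.
  rewrite patchE mem_setE in_itv /= /pareto.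
  by case: (1 <= z); case: (z <= b); rewrite ?(mul0r, mulr0, mul1r, mulr1).
move: b1; rewrite le_eqVlt => /predU1P[<-|b1].
  by rewrite set_itv1 integral_set1 invr1 subrr.
rewrite (@continuous_FTC2 _ _ (fun y => - y^-1))//.
- by rewrite -EFinB invr1 opprK addrC.
- apply: continuous_in_subspaceT => z; rewrite inE /= in_itv /= => /andP[z1 _].
  by apply: sqrV_continuous; rewrite gt_eqF// (lt_le_trans _ z1).
- split.
  + move=> z; rewrite in_itv /= => /andP[z1 _].
    by apply: derivable_Ninv; rewrite gt_eqF// (lt_trans _ z1).
  + by apply: cvg_at_right_filter; apply: Ninv_cvg; exact: oner_neq0.
  + apply: cvg_at_left_filter; apply: Ninv_cvg.
    by rewrite gt_eqF// (lt_trans _ b1).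
- move=> z; rewrite in_itv /= => /andP[z1 _].
  by rewrite derive1_Ninv// gt_eqF// (lt_trans _ z1).
Qed.

Lemma integral_pareto : (\int[mu]_z (pareto z)%:E = 1)%E.
Proof.
transitivity (\int[mu]_(z in `[1%R, +oo[) (z ^- 2)%:E)%E.
  rewrite [RHS]integral_mkcond; apply: eq_integral => z _.
  rewrite patchE mem_setE in_itv /= andbT /pareto.
  by case: (1 <= z); rewrite ?(mul0r, mul1r).
rewrite (@ge0_continuous_FTC2y _ _ (fun y => - y^-1) _ 0)//.
- by rewrite -EFinB invr1 opprK add0r.
- by move=> z _; rewrite invr_ge0 sqr_ge0.
- apply: continuous_in_subspaceT => z; rewrite inE /= in_itv /= andbT => z1.
  by apply: sqrV_continuous; rewrite gt_eqF// (lt_le_trans _ z1).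
- rewrite -oppr0; apply: cvgN; apply/gtr0_cvgV0; last exact: cvg_id.
  exact: nbhs_pinfty_gt.
- by move=> z z1; apply: derivable_Ninv; rewrite gt_eqF// (lt_trans _ z1).
- by apply: cvg_at_right_filter; apply: Ninv_cvg; exact: oner_neq0.
- move=> z; rewrite in_itv /= andbT => z1.
  by rewrite derive1_Ninv// gt_eqF// (lt_trans _ z1).
Qed.

(** The measure [v z^-2 dz] gives the interval from 1 to [v / m] the mass [v - m] if [m <= v], and 0
    otherwise. Writing this as [Num.max v m - m] matches the difference of two maxima that
    inclusion-exclusion yields for [eta]. In the application [m] is a weighted maximum that
    dominates a positive multiple of [v], hence the form of its positivity hypothesis. *)
Lemma integral_pareto_scaled (v m : R) : 0 <= v -> (0 < v -> 0 < m) -> 0 <= m ->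
  (\int[mu]_z ((Num.max z 1 * m <= v)%R%:R * (v * pareto z))%:E =
   (Num.max v m - m)%:E)%E.
Proof.
rewrite le_eqVlt => /predU1P[<- _ m0|v0 /(_ v0) m0 _].
  rewrite max_r// subrr; apply: integral0_eq => z _.
  by rewrite mul0r mulr0.
have [mv|vm] := leP m v; last first.
  rewrite subrr; apply: integral0_eq => z _; congr EFin.
  rewrite /pareto; case: (leP 1 z) => z1; last by rewrite mul0r !mulr0.
  rewrite (_ : (_ <= v)%R = false) ?mul0r//; apply/negbTE; rewrite -ltNge.
  by apply: lt_le_trans vm _; rewrite ?max_l// ler_peMl// ltW.
transitivity (\int[mu]_z (v%:E * (pareto z * (z <= v / m)%R%:R)%:E))%E.
  apply: eq_integral => z _; rewrite -EFinM; congr EFin.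
  rewrite ler_pdivlMr// /pareto; case: (leP 1 z) => z1; first by rewrite ?max_l//; ring.
  by rewrite !mul0r !mulr0.
rewrite ge0_integralZl//.
- rewrite integral_pareto_le; last by rewrite ler_pdivlMr// mul1r.
  by rewrite -EFinM invf_div mulrBr mulr1 mulrC divfK// gt_eqF.
- apply/measurable_EFinP; apply: measurable_funM; first exact: measurable_pareto.
  by apply: measurable_fun_nat_bool; apply: measurable_fun_ler.
- by move=> z _; rewrite lee_fin mulr_ge0// pareto_ge0.
- by rewrite lee_fin ltW.
Qed.

End pareto_density.

Lemma measurable_invr_ge0 (R : realType) (d : measure_display) (O : measurableType d)
    (f : O -> R) : (forall w, 0 <= f w) -> measurable_fun setT f ->
  measurable_fun setT (fun w => (f w)^-1).
Proof.
move=> f0 mf; rewrite (_ : (fun w => _) = (fun w => f w `^ (-1))).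
  exact: (measurableT_comp (measurable_powR _)).
by apply/funext => w; rewrite powR_inv1.
Qed.

(** An orthant is a sublevel set of the maximum with weights [1 / x j]; this serves the limit vector
    and the scaled process alike. *)
Lemma wmax_scale_le (R : realType) (m : nat) (x v : 'I_m -> R) (z u : R) :
  (forall j, 0 < x j) -> 0 < z -> 0 <= u ->
  [forall j, (z * v j <= u * x j)%R] = (z * wmax (fun j => (x j)^-1) v <= u).
Proof.
move=> x0 z0 u0; rewrite [z * wmax _ _]mulrC -ler_pdivlMr//.
have E j : (z * v j <= u * x j) = ((x j)^-1 * v j <= u / z).
  by rewrite ler_pdivlMr// -mulrA ler_pdivrMl// [v j * z]mulrC [x j * u]mulrC.
by apply/forallP/(wmax_leP _ _ (divr_ge0 u0 (ltW z0))) => h j; have := h j; rewrite E.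
Qed.

Section limit_law.
Variables (R : realType) (d : measure_display) (O : measurableType d).
Variables (P : probability O R) (k : nat) (v : 'I_k.+1 -> O -> R).
Hypothesis mv : forall j, measurable_fun setT (v j).
Hypothesis v_ge0 : forall j w, 0 <= v j w.
Hypothesis iv : forall j, P.-integrable setT (EFin \o v j).
Hypothesis Ev0 : (\int[P]_w (v ord0 w)%:E = 1)%E.

Local Notation mu := (@lebesgue_measure R).
Local Notation Pmu := (P \x mu)%E.
Let v0 := v ord0.

(* On the support of [limit_density] the max with 1 is vacuous; it makes all the
   coordinates nonnegative everywhere. *)
Definition limit_vector (p : O * R) : 'rV[R]_k.+1 :=
  \row_j (Num.max p.2 1 * (v j p.1 / v0 p.1)).

(** The factor [v0] is the change of measure to the tilted increments. Where it vanishes, the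
    quotients in [limit_vector] are default values without weight. *)
Definition limit_density (p : O * R) : R := v0 p.1 * pareto p.2.

Lemma limit_vector_ge0 p j : 0 <= limit_vector p ord0 j.
Proof.
rewrite mxE; apply: mulr_ge0; first by rewrite le_max ler01 orbT.
by apply: divr_ge0; exact: v_ge0.
Qed.

Lemma limit_vector_measurable j :
  measurable_fun setT (fun p => limit_vector p ord0 j).
Proof.
rewrite (_ : (fun p => _) = (fun p => Num.max p.2 1 * (v j p.1 / v0 p.1))); last first.
  by apply/funext => p; rewrite mxE.
apply: measurable_funM.
  by apply: measurable_maxr => //; exact: measurable_snd.
apply: (measurableT_comp (f := fun w => v j w / v0 w)); last exact: measurable_fst.
by apply: measurable_funM => //; apply: measurable_invr_ge0; [move=> w; exact: v_ge0|exact: mv].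
Qed.

Lemma limit_density_ge0 p : 0 <= limit_density p.
Proof. by apply: mulr_ge0; [exact: v_ge0|exact: pareto_ge0]. Qed.

Lemma limit_density_measurable : measurable_fun setT limit_density.
Proof.
apply: measurable_funM.
  by apply: (measurableT_comp (mv ord0)); exact: measurable_fst.
by apply: (measurableT_comp (@measurable_pareto R)); exact: measurable_snd.
Qed.

Lemma integral_limit_density : (\int[Pmu]_p (limit_density p)%:E = 1)%E.
Proof.
rewrite fubini_tonelli1; last 2 first.
- by apply/measurable_EFinP; exact: limit_density_measurable.
- by move=> p; rewrite lee_fin limit_density_ge0.
rewrite -Ev0; apply: eq_integral => w _; rewrite /fubini_F /limit_density /=.
under eq_integral do rewrite EFinM.
rewrite ge0_integralZl//; first by rewrite integral_pareto mule1.
- by apply/measurable_EFinP; exact: measurable_pareto.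
- by move=> z _; rewrite lee_fin pareto_ge0.
- by rewrite lee_fin; exact: v_ge0.
Qed.

Lemma limit_density_integrable : Pmu.-integrable setT (EFin \o limit_density).
Proof.
apply/integrableP; split; first by apply/measurable_EFinP; exact: limit_density_measurable.
under eq_integral do rewrite /= ger0_norm ?limit_density_ge0//.
by rewrite integral_limit_density ltry.
Qed.

Lemma wint_limit_one : wint Pmu limit_density (fun=> 1) = 1.
Proof.
rewrite /wint /Rintegral; under eq_integral do rewrite mul1r.
by rewrite integral_limit_density.
Qed.

Lemma wmax_integrable (c : 'I_k.+1 -> R) : (forall j, 0 < c j) ->
  P.-integrable setT (EFin \o (fun w => wmax c (v^~ w))).
Proof.
move=> c0; apply: (@le_integrable _ _ _ P setT measurableT _
    (EFin \o (fun w => \sum_j c j * v j w))).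
- apply/measurable_EFinP; apply: measurable_bigmax => j.
  exact: measurable_funM.
- move=> w _ /=; rewrite lee_fin ger0_norm ?wmax_ge0//.
  have c0' j : 0 <= c j * v j w by rewrite mulr_ge0// ltW.
  apply: le_trans (ler_norm _); apply/wmax_leP; first exact: sumr_ge0.
  by move=> j; rewrite (bigD1 j)//= lerDl sumr_ge0.
- apply: eq_integrable (integrable_sum measurableT (index_enum 'I_k.+1)
    (fun j _ => integrableZl measurableT (c j) (iv j))) => //.
  by move=> w _; rewrite /= sumEFin.
Qed.

Variable x : 'I_k.+1 -> R.
Hypothesis x0 : forall j, 0 < x j.

Definition inv_weight (j : 'I_k.+1) : R := (x j)^-1.

(** Raising the weight at [ord0] to at least 1 adjoins the coordinate [y ord0] itself to the
    maximum. The tail events at level [s] for [inv_weight1] and [inv_weight] then differ by the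
    event that [y ord0 > s] and [y j <= s * x j] for all [j]. *)
Definition inv_weight1 (j : 'I_k.+1) : R :=
  if j == ord0 then Num.max 1 (x j)^-1 else (x j)^-1.

Lemma inv_weight_gt0 j : 0 < inv_weight j.
Proof. by rewrite invr_gt0. Qed.

Lemma inv_weight1_gt0 j : 0 < inv_weight1 j.
Proof. by rewrite /inv_weight1; case: ifP => _; rewrite ?lt_max ?ltr01// invr_gt0. Qed.

Lemma wmax_inv_weight1 (y : 'I_k.+1 -> R) : (forall j, 0 <= y j) ->
  wmax inv_weight1 y = Num.max (y ord0) (wmax inv_weight y).
Proof.
move=> y0; apply/eqP; rewrite eq_le; apply/andP; split.
  apply/wmax_leP; first by rewrite le_max y0.
  move=> j; rewrite /inv_weight1; case: eqP => [->|_].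
    rewrite maxr_pMl// mul1r ge_max le_max lexx /= le_max.
    by rewrite (le_bigmax _ (fun j => inv_weight j * y j) ord0) orbT.
  by rewrite le_max (le_bigmax _ (fun j => inv_weight j * y j) j) orbT.
rewrite ge_max; apply/andP; split.
  apply: le_trans (le_bigmax _ (fun j => inv_weight1 j * y j) ord0).
  by rewrite /inv_weight1 eqxx ler_peMl// le_max lexx.
apply/wmax_leP; first exact: wmax_ge0.
move=> j; apply: le_trans (le_bigmax _ (fun j => inv_weight1 j * y j) j).
rewrite ler_wpM2r// /inv_weight1; case: eqP => // _.
by rewrite le_max lexx orbT.
Qed.

(** With [z] integrated first, each fiber is [integral_pareto_scaled] for [v0 w] and the maximum
    with weights [1 / x j]; the larger of these two is the maximum with the raised weight. *)
Lemma wint_limit_orthant : wint Pmu limit_density (orthant x \o limit_vector) =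
  \int[P]_w wmax inv_weight1 (v^~ w) - \int[P]_w wmax inv_weight (v^~ w).
Proof.
have i1 := wmax_integrable inv_weight1_gt0.
have i2 := wmax_integrable inv_weight_gt0.
rewrite -(RintegralB measurableT i1 i2) /wint /Rintegral; congr fine.
rewrite fubini_tonelli1; last 2 first.
- apply/measurable_EFinP; apply: measurable_funM; last exact: limit_density_measurable.
  by apply: measurable_orthant; exact: limit_vector_measurable.
- by move=> p; rewrite lee_fin mulr_ge0// limit_density_ge0.
apply: eq_integral => w _; rewrite wmax_inv_weight1//.
rewrite -[RHS]integral_pareto_scaled//; last 2 first.
- move=> vw; apply: lt_le_trans (le_bigmax _ (fun j => inv_weight j * v j w) ord0).
  by rewrite mulr_gt0// inv_weight_gt0.
- exact: wmax_ge0.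
rewrite /fubini_F; apply: eq_integral => z _; congr EFin.
rewrite /limit_density /= -/v0; have [v00|vn0] := eqVneq (v0 w) 0.
  by rewrite v00 !mul0r !mulr0.
congr (_ * _); rewrite /orthant; congr (nat_of_bool _)%:R.
have vw : 0 < v0 w by rewrite lt_neqAle eq_sym vn0 v_ge0.
have z1 : 0 < Num.max z 1 by rewrite lt_max ltr01 orbT.
rewrite -(wmax_scale_le (v^~ w) x0 z1 (ltW vw)).
apply: eq_forallb => j; rewrite mxE mulrA ler_pdivrMr//=.
by rewrite [x j * _]mulrC.
Qed.

End limit_law.

Lemma continuous_row (R : realType) (T : topologicalType) (m : nat)
    (h : 'I_m -> T -> R) : (forall j, continuous (h j)) ->
  continuous (fun y => \row_j h j y : 'rV[R]_m).
Proof.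
move=> ch y; apply/cvg_ballP => e e0.
have H : \forall z \near y, forall j, ball (h j y) e (h j z).
  apply: filter_forall => j.
  by have /cvg_ballP/(_ _ e0) := ch j y.
by apply: filterS H => z H; split=> // i j; rewrite !mxE.
Qed.

(* Coordinates relative to the first one, cut off below 1 to be continuous. *)
Definition increments (R : realType) (k : nat) (y : 'rV[R]_k.+1) : 'rV[R]_k.+1 :=
  \row_j (if j == ord0 then Num.max (y ord0 ord0) 1
          else y ord0 j / Num.max (y ord0 ord0) 1).

Lemma increments_continuous (R : realType) (k : nat) : continuous (@increments R k).
Proof.
have cc j : continuous (fun y : 'rV[R]_k.+1 => y ord0 j) by exact: coord_continuous.
have cm : continuous (fun y : 'rV[R]_k.+1 => Num.max (y ord0 ord0) 1).
  move=> y; apply: (continuous_max (f := fun y : 'rV[R]_k.+1 => y ord0 ord0)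
    (g := fun=> 1)); [exact: cc|exact: cst_continuous].
apply: continuous_row => j y; case: (j == ord0); first exact: cm.
apply: (continuousM (cc j y)).
apply: continuousV; last exact: cm.
by rewrite gt_eqF// lt_max ltr01 orbT.
Qed.

(** * The limit as a Pareto mixture of tilted conditional expectations *)

Section limit_identification.
Variables (R : realType) (d : measure_display) (O : measurableType d).
Variables (P : probability O R) (k : nat) (v : 'I_k.+1 -> O -> R).
Hypothesis mv : forall j, measurable_fun setT (v j).
Hypothesis v_ge0 : forall j w, 0 <= v j w.
Hypothesis iv : forall j, P.-integrable setT (EFin \o v j).
Hypothesis Ev0 : (\int[P]_w (v ord0 w)%:E = 1)%E.
Variables (f : 'rV[R]_k.+1 -> R) (M : R).
Hypothesis cf : continuous f.
Hypothesis fM : forall y, `|f y| <= M.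

Local Notation mu := (@lebesgue_measure R).
Local Notation Pmu := (P \x mu)%E.
Let v0 := v ord0.

Let F z w := f (\row_(j < k.+1) (if j == ord0 then z else v j w / v0 w)).

Let pos : set O := [set w | 0 < v0 w].

Let mpos : measurable pos.
Proof.
rewrite (_ : pos = ~` [set w | v0 w <= 0]); 
  first by apply: measurableC; apply: measurable_le; exact: mv.
apply/seteqP; split=> w /=; first by move=> h; apply/negP; rewrite -ltNge.
by move/negP; rewrite -ltNge.
Qed.

Let kappa : R := pr P pos.

Let kappaE : 1 - fine (P [set w | v0 w = 0]) = kappa.
Proof.
have -> : [set w | v0 w = 0] = ~` pos.
  apply/seteqP; split=> w /=; first by rewrite /pos /= => ->; rewrite ltxx.
  by move/negP; rewrite -leNgt => h; apply/eqP; rewrite eq_le h v_ge0.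
by rewrite -/(pr P _) prC// opprB addrC subrK.
Qed.

(** Otherwise [v0] would vanish almost surely, against its expectation 1. *)
Let kappa_gt0 : 0 < kappa.
Proof.
rewrite lt_neqAle pr_ge0 andbT eq_sym; apply/eqP => k0.
have P0 : P pos = 0%E by rewrite prE// -/kappa k0.
have : (\int[P]_w (v0 w)%:E = \int[P]_(w in pos) (v0 w)%:E)%E.
  rewrite [RHS]integral_mkcond; apply: eq_integral => w _; rewrite patchE.
  case: ifPn => //; rewrite notin_setE /= => /negP; rewrite -leNgt => h.
  by congr EFin; apply/eqP; rewrite eq_le h v_ge0.
have mp : measurable_fun pos (EFin \o v0).
  by apply/measurable_EFinP; apply: measurable_funTS; exact: mv.
rewrite Ev0 (null_set_integral mpos mp P0) => -[] H.
by have := oner_neq0 R; rewrite H eqxx.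
Qed.

Let F_off w z : ~ pos w -> F z w * v0 w = 0.
Proof.
move=> /negP; rewrite -leNgt => h.
by rewrite (_ : v0 w = 0) ?mulr0//; apply/eqP; rewrite eq_le h v_ge0.
Qed.

Let mF z : measurable_fun setT (F z).
Proof.
(* [z] may be negative: the nonnegative placeholder [Num.max z 0] fills its slot, and [h] puts [z]
   back. *)
pose X w : 'rV[R]_k.+1 := \row_j (if j == ord0 then Num.max z 0 else v j w / v0 w).
pose h (y : 'rV[R]_k.+1) := f (\row_j (if j == ord0 then z else y ord0 j)).
rewrite (_ : F z = h \o X); last first.
  apply/funext => w; rewrite /h /F /X /=; congr f.
  by apply/rowP => j; rewrite !mxE; case: ifP => // ->.
apply: measurable_continuous_comp.
- move=> w j; rewrite mxE; case: ifP => _; first by rewrite le_max lexx orbT.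
  by apply: divr_ge0; exact: v_ge0.
- move=> j; rewrite (_ : (fun w => _) =
    (fun w => if j == ord0 then Num.max z 0 else v j w / v0 w)); last first.
    by apply/funext => w; rewrite mxE.
  case: (j == ord0); first exact: measurable_cst.
  by apply: measurable_funM => //; apply: measurable_invr_ge0; [move=> w; exact: v_ge0|exact: mv].
- move=> y; apply: continuous_comp; last exact: cf.
  apply: continuous_row => j {}y; case: (j == ord0); first exact: cst_continuous.
  exact: coord_continuous.
Qed.

Let iF z : P.-integrable setT (EFin \o (fun w => F z w * v0 w)).
Proof.
by apply: (integrable_bounded_mul (M := M)); [exact: mF|move=> w; exact: fM|exact: iv].
Qed.

Let g := f \o @increments R k.

Let gY_integrable : Pmu.-integrable setT
  (EFin \o (fun p => g (limit_vector v p) * limit_density v p)).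
Proof.
refine (@integrable_bounded_mul R _ _ Pmu (g \o limit_vector v) (limit_density v) M _ _ _).
- apply: measurable_continuous_comp.
  + by move=> p j; exact: limit_vector_ge0.
  + by move=> j; exact: limit_vector_measurable.
  + by move=> y; apply: continuous_comp; [exact: increments_continuous|exact: cf].
- by move=> p; exact: fM.
- exact: limit_density_integrable.
Qed.

Let fiber z : 1 <= z ->
  (\int[P]_w (g (limit_vector v (w, z)) * limit_density v (w, z))%:E =
   (z ^- 2 * \int[P]_w (F z w * v0 w))%:E)%E.
Proof.
move=> z1; rewrite -RintegralZl// /Rintegral fineK; last first.
  apply: integrable_fin_num => //.
  by apply: eq_integrable (integrableZl measurableT (z ^- 2) (iF z)) => // w _.
apply: eq_integral => w _; congr EFin.
rewrite /limit_density /= /pareto z1 mul1r -/v0.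
have [v00|vn0] := eqVneq (v0 w) 0; first by rewrite v00 mul0r !mulr0.
rewrite [v0 w * _]mulrC mulrCA; congr (_ * (_ * _)); rewrite /g /F /=; congr f.
apply/rowP => j; rewrite !mxE /= -/v0 divff// mulr1 !(max_l z1).
by case: ifP => // _; rewrite mulrAC divff ?mul1r// gt_eqF// (lt_le_trans _ z1).
Qed.

(** [1 - p] is the probability of the conditioning event and cancels the normalisation in [condEx].
    The integral over that event is one over the whole space, because the integrand has the factor
    [v ord0]. What remains is the product integral with [w] integrated first. *)
Lemma wint_limit_condEx :
  (1 - fine (P [set w | v ord0 w = 0])) *
    fine (\int[mu]_(z in `[1, +oo[%classic)
      (z ^- 2 * condEx P [set w | 0 < v ord0 w]
        (fun w => f (\row_(j < k.+1) (if j == ord0 then z else v j w / v ord0 w))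
           * v ord0 w))%:E) =
  wint Pmu (limit_density v) (g \o limit_vector v).
Proof.
rewrite kappaE.
pose H z := \int[P]_w (F z w * v0 w).
have condE z : condEx P pos (fun w => F z w * v0 w) = H z / kappa.
  rewrite /condEx -/(pr P pos) -/kappa; congr (_ / _).
  rewrite integral_mkcond /H /Rintegral; congr fine; apply: eq_integral => w _.
  rewrite patchE; case: ifPn => //; rewrite notin_setE => /F_off ->//.
pose G := fubini_G P (EFin \o (fun p => g (limit_vector v p) * limit_density v p)).
have GE z : 1 <= z -> G z = (z ^- 2 * H z)%:E by exact: fiber.
have G0 z : z < 1 -> G z = 0%E.
  move=> z1; apply: integral0_eq => w _ /=; congr EFin.
  by rewrite /limit_density /pareto /= leNgt z1 mul0r !mulr0.
(* The tilt has total mass 1, so the bound of [f] passes to [H]; the Pareto density times [M] then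
   dominates [G]. *)
have HM z : `|H z| <= M.
  apply: le_trans (le_normr_Rintegral measurableT (iF z)) _.
  rewrite (_ : M = \int[P]_w (M * v0 w)); last first.
    by rewrite (RintegralZl M measurableT (iv ord0)) /Rintegral Ev0 mulr1.
  apply: le_Rintegral => //; first exact: integrable_norm (iF z).
    by apply: eq_integrable (integrableZl measurableT M (iv ord0)) => // w _.
  by move=> w _; rewrite normrM (ger0_norm (v_ge0 _ _)) ler_wpM2r// ?fM ?v_ge0.
have iG : mu.-integrable setT G.
  have ip : mu.-integrable setT (EFin \o @pareto R).
    apply/integrableP; split; first by apply/measurable_EFinP; exact: measurable_pareto.
    under eq_integral do rewrite /= ger0_norm ?pareto_ge0//.
    by rewrite integral_pareto ltry.
  apply: (le_integrable measurableT (measurable_fubini_G gY_integrable) _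
    (integrableZl measurableT M ip)) => z _.
  suff : (`|G z| <= `|M%:E * (pareto z)%:E|)%E by [].
  have [z1|z1] := leP 1 z; last by rewrite G0// abse0.
  rewrite GE// -EFinM /= lee_fin /pareto z1 mul1r mulrC !normrM.
  by rewrite ler_wpM2r// (le_trans (HM z))// ler_norm.
have iH : mu.-integrable `[1, +oo[%classic (EFin \o (fun z => z ^- 2 * H z)).
  have iGS : mu.-integrable `[1, +oo[%classic G by apply: integrableS iG.
  apply: eq_integrable iGS => // z.
  by rewrite inE /= in_itv /= andbT => /GE ->.
transitivity (\int[mu]_(z in `[1, +oo[%classic) (z ^- 2 * H z)).
  have -> : fine (\int[mu]_(z in `[1%R, +oo[%classic)
      (z ^- 2 * condEx P pos (fun w => F z w * v0 w))%:E) =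
      \int[mu]_(z in `[1, +oo[%classic) (kappa^-1 * (z ^- 2 * H z)).
    by apply: eq_Rintegral => z _; rewrite condE; ring.
  by rewrite RintegralZl// mulrA divff ?mul1r// gt_eqF.
rewrite /wint /Rintegral; congr fine.
transitivity (\int[mu]_z G z)%E; last exact: integral21_prod_meas1.
rewrite integral_mkcond; apply: eq_integral => z _.
rewrite patchE mem_setE in_itv /= andbT; case: (leP 1 z) => [/GE ->//|/G0 ->//].
Qed.

End limit_identification.

(** * Conditioning on an exceedance *)

Section conditioned_process.
Variables (R : realType) (d : measure_display) (O : measurableType d).
Variables (P : probability O R) (k : nat) (e : 'I_k.+1 -> O -> R).
Hypothesis me : forall j, measurable_fun setT (e j).
Hypothesis e_ge0 : forall j w, 0 <= e j w.
Variable a : R.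
Hypothesis a1 : 1 <= a.

Let a0 : 0 < a. Proof. exact: lt_le_trans a1. Qed.

Definition exceed : set O := [set w | a < e ord0 w].

(** The factor [a] brings the total mass to 1 in the limit and cancels in conditional
    expectations. *)
Definition exceed_density (w : O) : R := a * (a < e ord0 w)%R%:R.

Definition scaled_vector (w : O) : 'rV[R]_k.+1 := \row_j (e j w / a).

Lemma measurable_gt (X : O -> R) : measurable_fun setT X ->
  measurable [set w | a < X w].
Proof.
move=> mX; rewrite (_ : [set _ | _] = ~` [set w | X w <= a]).
  by apply: measurableC; exact: measurable_le.
apply/seteqP; split=> w /=; first by move=> h; apply/negP; rewrite -ltNge.
by move/negP; rewrite -ltNge.
Qed.

Lemma exceed_density_ge0 w : 0 <= exceed_density w.
Proof. by rewrite mulr_ge0// ltW. Qed.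

Lemma exceed_density_integrable : P.-integrable setT (EFin \o exceed_density).
Proof.
apply: (@eq_integrable _ _ _ P setT measurableT (EFin \o (fun w =>
  exceed_density w * 1))); first by move=> w _; rewrite /= mulr1.
apply: (integrable_bounded_mul (M := a)).
- apply: measurable_funM => //; apply: measurable_fun_nat_bool.
  exact: measurable_fun_ltr.
- move=> w; rewrite ger0_norm ?exceed_density_ge0//.
  rewrite /exceed_density ler_piMr ?(ltW a0)// lern1.
  by case: (a < _)%R.
- exact: finite_measure_integrable_cst.
Qed.

Lemma scaled_vector_ge0 w j : 0 <= scaled_vector w ord0 j.
Proof. by rewrite mxE divr_ge0// ltW. Qed.

Lemma scaled_vector_measurable j :
  measurable_fun setT (fun w => scaled_vector w ord0 j).
Proof.
rewrite (_ : (fun w => _) = (fun w => e j w / a)); first exact: measurable_funM.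
by apply/funext => w; rewrite mxE.
Qed.

Lemma wint_exceed (A : set O) (phi : O -> R) : measurable A ->
  (forall w, phi w * exceed_density w = a * \1_A w) ->
  wint P exceed_density phi = a * pr P A.
Proof.
move=> mA phiE; rewrite /wint pr_Rintegral// -RintegralZl//; last first.
  exact: integrable_indic.
by apply: eq_Rintegral => w _; exact: phiE.
Qed.

Lemma wint_exceed_one : wint P exceed_density (fun=> 1) = a * pr P exceed.
Proof.
apply: wint_exceed; first exact: measurable_gt.
move=> w; rewrite mul1r /exceed_density indicE; congr (_ * (nat_of_bool _)%:R).
by apply/idP/idP; rewrite inE.
Qed.

(** Exceedance together with the orthant is the difference of two nested tail events, by
    [wmax_inv_weight1]; the identity is exact at each level. *)
Lemma wint_exceed_orthant (x : 'I_k.+1 -> R) : (forall j, 0 < x j) ->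
  wint P exceed_density (orthant x \o scaled_vector) =
  a * pr P [set w | a < wmax (inv_weight1 x) (e^~ w)] -
  a * pr P [set w | a < wmax (inv_weight x) (e^~ w)].
Proof.
move=> x0.
have mw c : measurable [set w | a < wmax c (e^~ w)].
  by apply: measurable_gt; apply: measurable_bigmax => j; exact: measurable_funM.
have sub : [set w | a < wmax (inv_weight x) (e^~ w)] `<=`
    [set w | a < wmax (inv_weight1 x) (e^~ w)].
  by move=> w /=; rewrite wmax_inv_weight1// lt_max => ->; rewrite orbT.
rewrite (@wint_exceed ([set w | a < wmax (inv_weight1 x) (e^~ w)] `\`
    [set w | a < wmax (inv_weight x) (e^~ w)])).
- rewrite prD; [|exact: mw|exact: mw].
  by rewrite (setIidr sub) mulrBr.
- by apply: measurableD; exact: mw.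
move=> w; rewrite mulrCA; congr (_ * _).
rewrite /orthant /= -natrM mulnb indicE; congr (nat_of_bool _)%:R.
have -> : [forall j, (scaled_vector w ord0 j <= x j)%R] =
    (wmax (inv_weight x) (e^~ w) <= a).
  rewrite -[wmax _ _]mul1r -(wmax_scale_le _ x0 ltr01 (ltW a0)).
  by apply: eq_forallb => j; rewrite mxE ler_pdivrMr// mul1r mulrC.
apply/andP/idP => [[h1 h2]|].
  rewrite inE /=; split; last by apply/negP; rewrite -leNgt.
  by rewrite wmax_inv_weight1// lt_max h2.
rewrite inE /= wmax_inv_weight1// lt_max => -[h1 /negP]; rewrite -leNgt => h2.
by split=> //; move: h1; rewrite [X in _ || X]ltNge h2 orbF.
Qed.

(** On the exceedance event the first scaled coordinate is above 1, so the maxima in [increments]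
    are inactive and the level cancels from the quotients of scaled coordinates. *)
Lemma condEx_exceed (f : 'rV[R]_k.+1 -> R) (M : R) :
  continuous f -> (forall y, `|f y| <= M) ->
  condEx P exceed (fun w => f (\row_(j < k.+1)
    (if j == ord0 then e ord0 w / a else e j w / e ord0 w))) =
  wint P exceed_density ((f \o @increments R k) \o scaled_vector) /
  wint P exceed_density (fun=> 1).
Proof.
move=> cf fM; rewrite wint_exceed_one /condEx -/(pr P exceed).
pose F w := f (\row_(j < k.+1)
  (if j == ord0 then e ord0 w / a else e j w / e ord0 w)).
pose G w := F w * (a < e ord0 w)%R%:R.
have inE' w : (w \in exceed) = (a < e ord0 w) by apply/idP/idP; rewrite inE.
have -> : fine (\int[P]_(w in exceed) (F w)%:E) = \int[P]_w G w.
  rewrite integral_mkcond /Rintegral; congr fine; apply: eq_integral => w _.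
  by rewrite patchE inE' /G; case: (a < _)%R; rewrite ?mulr1 ?mulr0.
have GE w : ((f \o @increments R k) \o scaled_vector) w * exceed_density w = a * G w.
  rewrite /exceed_density /G /F /=; case: (ltP a (e ord0 w)) => h; last by rewrite !mulr0.
  rewrite !mulr1 mulrC; congr (_ * f _); apply/rowP => j; rewrite !mxE.
  have ea : 1 <= e ord0 w / a by rewrite ler_pdivlMr// mul1r ltW.
  rewrite !(max_l ea); case: ifP => // _.
  by rewrite invf_div mulrA divfK// gt_eqF.
have iX : P.-integrable setT (EFin \o (fun w => a * G w)).
  rewrite (_ : (fun w => _) = (fun w =>
    ((f \o @increments R k) \o scaled_vector) w * exceed_density w)); last first.
    by apply/funext => w; rewrite GE.
  apply: (integrable_bounded_mul (M := M)).
  - apply: measurable_continuous_comp.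
    + exact: scaled_vector_ge0.
    + exact: scaled_vector_measurable.
    + by move=> y; apply: continuous_comp; [exact: increments_continuous|exact: cf].
  - by move=> w; exact: fM.
  - exact: exceed_density_integrable.
have iG : P.-integrable setT (EFin \o G).
  apply: eq_integrable (integrableZl measurableT a^-1 iX) => // w _ /=.
  by rewrite -EFinM mulKf// gt_eqF.
rewrite /wint; under [in RHS]eq_Rintegral do rewrite GE.
by rewrite RintegralZl// -mulf_div divff ?mul1r// gt_eqF.
Qed.

End conditioned_process.

(** * Convergence of the conditional laws *)

Unset Implicit Arguments.
Set Strict Implicit.
Set Printing Implicit Defensive.

(** The limit law is given by its integrals of bounded continuous [f]. Slot [ord0] holds the Pareto
    coordinate, of density [z ^- 2] on [[1, +oo[], and independence is the iterated integral. By the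
    tower property, integrating against the conditional expectation of V^(1)(t_0) given the
    increments amounts to the factor [V t0 w] under conditioning on [0 < V t0 w]. *)
Theorem theorem2p1 (R : realType) (T : Type)
  (* the max-stable process xi and its spectral representation *)
  (d2 : measure_display) (O2 : measurableType d2) (P2 : probability O2 R)
  (V : T -> O2 -> R) (U : nat -> O2 -> R) (Vs : nat -> T -> O2 -> R)
  (xi : T -> O2 -> R)
  (hVmeas : forall t, measurable_fun [set: O2] (V t))
  (hV0 : forall t w, 0 <= V t w)
  (hEV : forall t, (\int[P2]_w (V t w)%:E = 1)%E)
  (hU : PPP_u2 P2 U)
  (hVsmeas : forall i t, measurable_fun [set: O2] (Vs i t))
  (hVs : forall i, same_fdd P2 P2 (Vs i) V)
  (hindep : mutually_indep P2
     (fun o : option nat => match o with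
                            | None => cyl U
                            | Some i => cyl (Vs i) end))
  (hxi : forall t w, xi t w = sup (range (fun i => U i w * Vs i t w)))
  (* the process eta and its independent copies *)
  (d1 : measure_display) (O1 : measurableType d1) (P1 : probability O1 R)
  (eta : T -> O1 -> R) (etas : nat -> T -> O1 -> R)
  (heta_meas : forall t, measurable_fun [set: O1] (eta t))
  (heta0 : forall t w, 0 <= eta t w)
  (hetas_meas : forall i t, measurable_fun [set: O1] (etas i t))
  (hetas : forall i, same_fdd P1 P1 (etas i) eta)
  (hetas_indep : mutually_indep P1 (fun i : nat => cyl (etas i)))
  (* max-domain of attraction with c_n = 1/n, b_n = 0 (fdd convergence) *)
  (hMDA : forall (m : nat) (s : 'I_m -> T),
     cvg_in_law P1 P2
       (fun n w => \row_(j < m)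
          ((n.+1)%:R^-1 * \big[Num.max/0]_(i < n.+1) etas i (s j) w))
       (fun w => \row_(j < m) xi (s j) w))
  (a : nat -> R) (ha : a @ \oo --> +oo)
  (k : nat) (t : 'I_k.+1 -> T) :
  let t0 := t ord0 in
  let p := fine (P2 [set w | V t0 w = 0]) in
  forall f : 'rV[R]_k.+1 -> R, continuous f -> (exists M : R, forall x, `|f x| <= M) ->
    (fun n => condEx P1 [set w | a n < eta t0 w]
        (fun w => f (\row_(j < k.+1)
             (if j == ord0 then eta t0 w / a n else eta (t j) w / eta t0 w))))
    @ \oo -->
    (1 - p) * fine (\int[lebesgue_measure]_(z in `[1, +oo[%classic)
        (z ^- 2 * condEx P2 [set w | 0 < V t0 w]
           (fun w => f (\row_(j < k.+1)
                (if j == ord0 then z else V (t j) w / V t0 w)) * V t0 w))%:E).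
Proof.
move=> t0 p f cf [M fM].
pose v j := V (t j); pose e j := eta (t j).
have mv j : measurable_fun setT (v j) by exact: hVmeas.
have v0 j w : 0 <= v j w by exact: hV0.
have iv j : P2.-integrable setT (EFin \o v j) by exact: (V_integrable hVmeas hV0 hEV).
have Ev : (\int[P2]_w (v ord0 w)%:E = 1)%E by exact: hEV.
have me j : measurable_fun setT (e j) by exact: heta_meas.
have e0 j w : 0 <= e j w by exact: heta0.
pose L := wint (P2 \x lebesgue_measure)%E (limit_density v)
  ((f \o @increments R k) \o limit_vector v).
have LE := wint_limit_condEx mv v0 iv Ev cf fM.
set rhs := (1 - p) * _.
have -> : rhs = L by exact: LE.
(* [a n] may be below 1, even negative, for finitely many [n]; [a'] agrees with it from some index
   on. *)
pose a' n := Num.max (a n) 1.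
have a'1 n : 1 <= a' n by rewrite le_max lexx orbT.
have a'y : a' @ \oo --> +oo.
  apply/cvgryPge => A; have /cvgryPge/(_ A) := ha.
  by apply: filterS => n An; rewrite le_max An.
have tail m (s : 'I_m -> T) (c : 'I_m -> R) (c0 : forall j, 0 < c j) :
    (fun n => a' n * pr P1 [set w | a' n < wmax c (fun j => eta (s j) w)]) @ \oo -->
    \int[P2]_w wmax c (fun j => V (s j) w).
  exact: (tail_wmax hVmeas hV0 hEV hU hVsmeas hVs hindep hxi heta_meas
    hetas_meas hetas hetas_indep hMDA a'y).
(* The total mass is the scaled tail of a maximum over the single site [t0] with weight 1, so its
   limit is the expectation of [V t0]. *)
have c1 : (fun n => wint P1 (exceed_density e (a' n)) (fun=> 1)) @ \oo --> (1 : R).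
  have w1 (y : R) : 0 <= y -> wmax (fun _ : 'I_1 => 1) (fun=> y) = y.
    by move=> y0; rewrite /wmax big_ord_recl big_ord0 mul1r max_l.
  have -> : (fun n => wint P1 (exceed_density e (a' n)) (fun=> 1)) =
      (fun n => a' n * pr P1 [set w | a' n < wmax (fun _ : 'I_1 => 1) (fun=> eta t0 w)]).
    apply/funext => n; rewrite wint_exceed_one//; congr (_ * pr P1 _).
    by apply/seteqP; split=> w; rewrite /exceed /= w1.
  have E1 : \int[P2]_w wmax (fun _ : 'I_1 => 1) (fun=> V t0 w) = 1.
    by rewrite /Rintegral; under eq_integral do rewrite w1//; rewrite hEV.
  by have := tail 1%N (fun=> t0) (fun=> 1) (fun=> ltr01); rewrite E1.
have co x : (forall j, 0 < x j) ->
    (fun n => wint P1 (exceed_density e (a' n)) (orthant x \o scaled_vector e (a' n)))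
      @ \oo -->
    wint (P2 \x lebesgue_measure)%E (limit_density v) (orthant x \o limit_vector v).
  move=> x0; rewrite wint_limit_orthant//.
  rewrite (_ : (fun n => _) = (fun n =>
    a' n * pr P1 [set w | a' n < wmax (inv_weight1 x) (e^~ w)] -
    a' n * pr P1 [set w | a' n < wmax (inv_weight x) (e^~ w)])); last first.
    by apply/funext => n; rewrite wint_exceed_orthant.
  by apply: cvgB; apply: tail => j; [exact: inv_weight1_gt0|exact: inv_weight_gt0].
have key : (fun n => wint P1 (exceed_density e (a' n))
    ((f \o @increments R k) \o scaled_vector e (a' n))) @ \oo --> L.
  apply: (portmanteau (M := M)) => //.
  - by move=> n w; exact: exceed_density_ge0.
  - by move=> w; exact: limit_density_ge0.
  - by move=> n; exact: exceed_density_integrable.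
  - exact: limit_density_integrable.
  - by move=> n w j; exact: scaled_vector_ge0.
  - by move=> w j; exact: limit_vector_ge0.
  - by move=> n j; exact: scaled_vector_measurable.
  - by move=> j; exact: limit_vector_measurable.
  - by rewrite wint_limit_one.
  - by move=> y; apply: continuous_comp; [exact: increments_continuous|exact: cf].
  - by move=> y; exact: fM.
(* Conditional expectations are ratios by the total mass, which tends to 1. *)
have kc : (fun n => wint P1 (exceed_density e (a' n))
    ((f \o @increments R k) \o scaled_vector e (a' n)) /
    wint P1 (exceed_density e (a' n)) (fun=> 1)) @ \oo --> L.
  rewrite -[L]divr1; apply: cvgM => //.
  by apply: cvgV => //; exact: oner_neq0.
apply: cvg_trans kc; apply: near_eq_cvg.
have /cvgryPge/(_ 1) := ha; apply: filterS => n an.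
have aE : a n = a' n by rewrite /a' max_l.
by rewrite aE -(condEx_exceed P1 me e0 (a'1 n) cf fM).
Qed.
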